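(* Let $\alpha\in(0,1)$, and let $A(z)=\sum_{m=0}^\infty A_mz^m$, where $A_m$ are complex $n\times n$ matrices, the series converges on a neighbourhood of the origin, and $A_0$ is Hermitian with eigenvalues $\lambda_1,\ldots,\lambda_n\in\mathbb R$ (listed with multiplicity). Choose the basis so that $A_0$ is diagonal, that is, replace $A(z)$ by $U^*A(z)U$ where $U$ is a unitary matrix with $U^*A_0U=\operatorname{diag}(\lambda_1,\ldots,\lambda_n)$, so that $A_0=\operatorname{diag}(\lambda_1,\ldots,\lambda_n)$. Suppose that the system $$t^\alpha\left(D_{0+}^\alpha u\right)(t)=A(t^\alpha)u(t)$$ has a good spectrum, i.e. $$\gamma(\lambda_j)-\gamma(\lambda_i)\notin\alpha\mathbb N\quad\text{for all } i,j\in\{1,\ldots,n\},\qquad \mathbb N=\{1,2,\ldots\}.$$ Then the system possesses a fundamental solution, that is, a matrix-valued solution of the form $$u(t)=S(t^\alpha)\,\psi(t),\qquad \psi(t)=\operatorname{diag}\left(t^{\gamma(\lambda_1)},\ldots,t^{\gamma(\lambda_n)}\right),\qquad S(z)=\sum_{\nu=0}^\infty\sigma_\nu z^\nu,\quad \sigma_0=I,$$ with $n\times n$ matrices $\sigma_\nu$, where the power series for $S(z)$ has a positive radius of convergence (the equation being satisfied for all sufficiently small $t>0$).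
   Context: $D_{0+}^\alpha$ is the Riemann-Liouville fractional derivative of order $\alpha$, $$\left(D_{0+}^\alpha\varphi\right)(t)=\frac1{\Gamma(1-\alpha)}\frac{d}{dt}\int_0^t(t-\tau)^{-\alpha}\varphi(\tau)\,d\tau,\quad t>0,$$ applied entrywise to matrix-valued functions; it is defined for some functions singular at the origin, e.g. $D_{0+}^\alpha t^d=\frac{\Gamma(d+1)}{\Gamma(d+1-\alpha)}t^{d-\alpha}$ for $d>-1$ (with $1/\Gamma=0$ at the poles of $\Gamma$). Let $$\rho(t)=\frac{\Gamma(t+1)}{\Gamma(t+1-\alpha)},\qquad -1<t<\infty$$ (with $\rho(\alpha-1)=0$). The function $\rho$ is continuous and strictly increasing on $(-1,\infty)$, with range $(-\infty,\infty)$; $\gamma:\mathbb R\to(-1,\infty)$ denotes its inverse function, so that $\rho(\gamma(\lambda))=\lambda$ for all $\lambda\in\mathbb R$. *)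

(* Defs.v *)
From HB Require Import structures.
From mathcomp Require Import all_boot all_order all_algebra.
From mathcomp Require Import complex.
From mathcomp Require Import all_classical all_reals all_analysis.

Set Implicit Arguments.
Unset Strict Implicit.
Unset Printing Implicit Defensive.

Import Order.TTheory GRing.Theory Num.Theory numFieldNormedType.Exports.

Local Open Scope classical_set_scope.
Local Open Scope ring_scope.
Local Open Scope complex_scope.

Section Gamma.
Variable R : realType.
Implicit Types x t a l : R.

Definition Euler_integral x : R :=
  \int[lebesgue_measure]_(t in `]0, +oo[%classic) (t `^ (x - 1) * expR (- t)).

(* For x <= 0 this is Gamma (x + N) / (x (x + 1) ... (x + N - 1)) for an N
   with x + N > 0. At the poles 0, -1, -2, ... the denominator vanishes, so
   that Gamma x = 0 and, as 0^-1 = 0, also (Gamma x)^-1 = 0: the latter is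
   the value of the entire function 1 / Gamma there. *)
Definition Gamma x : R :=
  if 0 < x then Euler_integral x
  else let N := (Num.truncn (- x)).+1 in
       Euler_integral (x + N%:R) / \prod_(k < N) (x + k%:R).

(* Only meaningful for t > -1; in particular rho a (a - 1) = 0. *)
Definition rho a t : R := Gamma (t + 1) / Gamma (t + 1 - a).

(* The inverse of rho a restricted to ]-1, +oo[. *)
Definition rho_inv a l : R := xget 0 [set x | -1 < x /\ rho a x = l].

End Gamma.

Section RiemannLiouville.
Variables (R : realType) (a : R).

Definition RL_kernel (f : R -> R) (s tau : R) : R := (s - tau) `^ (- a) * f tau.

(* Without the factor 1 / Gamma (1 - a). *)
Definition RL_integral (f : R -> R) (s : R) : R :=
  \int[lebesgue_measure]_(tau in `]0, s[%classic) RL_kernel f s tau.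

(* Integrals and derivatives are total functions: their existence, here and
   in the entrywise version, has to be required separately. *)
Definition RL_derivable (f : R -> R) (t : R) : Prop :=
  (\forall s \near t,
    lebesgue_measure.-integrable `]0, s[%classic (EFin \o RL_kernel f s)) /\
  derivable (RL_integral f) t 1.

Definition RL_derive (f : R -> R) (t : R) : R :=
  (Gamma (1 - a))^-1 * derive1 (RL_integral f) t.

Definition mxRL_derivable n (u : R -> 'M[R[i]]_n) (t : R) : Prop :=
  forall i j, RL_derivable (fun s => complex.Re (u s i j)) t /\
              RL_derivable (fun s => complex.Im (u s i j)) t.

Definition mxRL_derive n (u : R -> 'M[R[i]]_n) (t : R) : 'M[R[i]]_n :=
  \matrix_(i, j) (RL_derive (fun s => complex.Re (u s i j)) t +i*
                  RL_derive (fun s => complex.Im (u s i j)) t).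

End RiemannLiouville.

Section MatrixPowerSeries.
Variables (R : realType) (n : nat).
Implicit Types (A : nat -> 'M[R[i]]_n) (z : R[i]).

(* R[i]^o carries the normed-space topology of the complex numbers. *)
Definition mxps_partial A z (i j : 'I_n) : nat -> R[i]^o :=
  series (fun m => z ^+ m * A m i j : R[i]^o).

Definition mxps_cvg A z : Prop := forall i j, cvgn (mxps_partial A z i j).

Definition mxps_sum A z : 'M[R[i]]_n :=
  \matrix_(i, j) (limn (mxps_partial A z i j) : R[i]).

Definition positive_radius A : Prop :=
  exists2 r : R, 0 < r & forall z, `|z| < r%:C -> mxps_cvg A z.

End MatrixPowerSeries.

Section System.
Variables (R : realType) (n : nat) (a : R).

Definition solves_system_at (A : nat -> 'M[R[i]]_n) (u : R -> 'M[R[i]]_n)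
    (t : R) : Prop :=
  mxRL_derivable a u t /\
  (t `^ a)%:C *: mxRL_derive a u t = mxps_sum A (t `^ a)%:C *m u t.

Definition good_spectrum (lambda : 'I_n -> R) : Prop :=
  forall (i j : 'I_n) (k : nat), (0 < k)%N ->
    rho_inv a (lambda j) - rho_inv a (lambda i) <> a * k%:R.

Definition psi (lambda : 'I_n -> R) (t : R) : 'M[R[i]]_n :=
  diag_mx (\row_i (t `^ rho_inv a (lambda i))%:C).

End System.

(* Main.v *)
Require Import Defs.
From HB Require Import structures.
From mathcomp Require Import all_boot all_order all_algebra.
From mathcomp Require Import complex.
From mathcomp Require Import all_classical all_reals all_analysis.
From mathcomp Require Import measurable_realfun ring lra.
Import Order.TTheory GRing.Theory Num.Theory numFieldNormedType.Exports.
Local Open Scope classical_set_scope.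
Local Open Scope sesquilinear_scope.
Local Open Scope ring_scope.
Local Open Scope complex_scope.
Set Implicit Arguments.
Unset Strict Implicit.
Unset Printing Implicit Defensive.
Set SsrOldRewriteGoalsOrder.

(** The theorem is an instance of the Frobenius method. Write a for the order,
    g_j = gamma(lambda_j), and look for u(t) = S(t^a) psi(t), whose (i, j) entry
    is the sum over k of sigma_k(i, j) t^(a k + g_j). Since the fractional
    derivative maps t^d to rho(d) t^(d-a), comparing coefficients of
    t^(a k + g_j) turns the system into

      (rho(a k + g_j) - lambda_i) sigma_k(i, j)
        = sum over 1 <= m <= k of (A_m sigma_(k-m))(i, j).

    For k = 0 the identity matrix is a solution because rho(g_j) = lambda_j. For
    k >= 1 the divisor vanishes only if rho(a k + g_j) = rho(g_i), that is, rho
    being injective, if g_i - g_j = a k; a good spectrum excludes this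
    ([nonresonant]). So the recursion determines all sigma_k. As rho tends to
    infinity, the inverse divisors are bounded ([rho_sub_inv_bounded]), and the
    geometric growth of the A_m is inherited by the sigma_k
    ([frobenius_coefs_geom]), which gives S a positive radius of convergence.

    Two analytic facts carry this argument.

    The function rho is a strictly increasing bijection from ]-1, +oo[ to the
    reals ([rho_lt], [rho_surj]). Tonelli's theorem gives Gamma p Gamma q =
    B(p, q) Gamma(p + q) ([eGammaM]), and with it the recurrence of Gamma and two
    expressions of rho in terms of Beta integrals ([rho_Beta], [rho_BetaV]), from
    which monotonicity and continuity are read off; the recurrence of rho
    ([rho_rec]) gives its limits at both ends.

    The fractional derivative of the series may be computed termwise
    ([RL_derive_series]): the fractional integral by dominated convergence, with
    the leading power as dominating function, and the ordinary derivative because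
    the result is a power of s times a power series in s^a.

    On the other side of the system the product A S is expanded by the Cauchy
    product of the two power series ([mxps_mul]). *)

(** * Real powers, sums and integrals *)

Lemma gt0_powRD (R : realType) (x p q : R) : 0 < x -> x `^ (p + q) = x `^ p * x `^ q.
Proof. by move=> x0; rewrite powRD//; apply/implyP => _; rewrite gt_eqF. Qed.

Lemma ler_powRl (R : realType) (a x y : R) :
  0 <= a -> 0 <= x -> x <= y -> x `^ a <= y `^ a.
Proof.
by move=> a0 x0 xy; apply: ge0_ler_powR; rewrite // nnegrE// (le_trans x0).
Qed.

Lemma is_derive_powR (R : realType) (x p : R) : 0 < x ->
  is_derive x 1 ((@powR R) ^~ p) (p * x `^ (p - 1)).
Proof.
move=> x0; have x0' : x \in `]0, +oo[ by rewrite in_itv/= andbT.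
by apply: DeriveDef; [exact: derivable_powR|rewrite -derive1E powR_derive1].
Qed.

Lemma ler_term_sum (R : realType) (I : finType) (F : I -> R) i :
  (forall j, 0 <= F j) -> F i <= \sum_j F j.
Proof. by move=> F0; rewrite (bigD1 i)//= lerDl sumr_ge0. Qed.

Section LebesgueAffine.
Variable R : realType.
Local Notation mu := (@lebesgue_measure R).

Let affine (c b : R) : measurableTypeR R -> measurableTypeR R := fun x => c * x + b.

Lemma measurable_affine (c b : R) : measurable_fun setT (affine c b).
Proof. by apply: measurable_funD => //; exact: measurable_funM. Qed.

(** Lebesgue measure is determined by its values on half-open intervals, and
    there it agrees with c times its own image under x |-> c * x + b. *)
Lemma ge0_integral_affine (c b : R) (f : measurableTypeR R -> \bar R) : (0 < c)%R ->
  measurable_fun setT f -> (forall x, 0 <= f x)%E ->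
  (\int[mu]_x f x = c%:E * \int[mu]_x f (c * x + b)%R)%E.
Proof.
move=> c0 mf f0.
pose m0 := mscale (NngNum (ltW c0)) (pushforward mu (affine c b)).
pose m : {measure set (measurableTypeR R) -> \bar R} := m0 (measurable_affine c b).
have mE (A : set (measurableTypeR R)) : measurable A -> mu A = m A.
  apply: lebesgue_measure_unique => _ [[u v]] _ <-.
  rewrite /m /m0 /mscale/= /pushforward.
  transitivity (c%:E * mu (affine c b @^-1` [set` `]u, v]]))%E; last by [].
  have -> : affine c b @^-1` [set` `]u, v]] = [set` `]((u - b) / c), ((v - b) / c)]].
    apply/seteqP; split => x /=; rewrite /affine !in_itv/= ltr_pdivrMr//
      ler_pdivlMr// ltrBlDr lerBrDr (mulrC c)//.
  rewrite !lebesgue_measure_itv/= !lte_fin ltr_pM2r ?invr_gt0// ltrD2r.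
  case: ifPn => uv; last by rewrite mule0.
  rewrite -!EFinB -EFinM; congr (_%:E).
  by field; rewrite gt_eqF.
rewrite (@eq_measure_integral _ _ _ _ m); last first.
  by move=> A mA _; exact: mE.
rewrite /m /m0 ge0_integral_mscale//= ge0_integral_pushforward//.
exact: measurable_affine.
Qed.

(** A nonnegative function with zero integral vanishes almost everywhere,
    whereas a nonempty open interval has positive measure. *)
Lemma integral_itv_gt0 (a b : R) (f : measurableTypeR R -> \bar R) :
  a < b -> measurable_fun setT f -> (forall x, 0 <= f x)%E ->
  (forall x : R, (a < x < b)%R -> 0 < f x)%E -> (0 < \int[mu]_x f x)%E.
Proof.
move=> ab mf f0 fpos; rewrite lt0e integral_ge0// andbT; apply/eqP => If0.
have : (\int[mu]_x `|f x| = 0)%E.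
  by rewrite -[RHS]If0; apply: eq_integral => x _; rewrite gee0_abs.
move/(ae_eq_integral_abs _ measurableT mf).1 => [N [mN N0 subN]].
have : (mu `]a, b[%classic <= mu N)%E.
  apply: le_measure; [by rewrite inE; exact: measurable_itv|by rewrite inE|].
  apply: subset_trans subN => x/=; rewrite in_itv/= => /fpos fx /(_ I) fx0.
  by rewrite fx0 ltxx in fx.
rewrite N0 lebesgue_measure_itv/= lte_fin ab leNgt.
by rewrite -EFinB lte_fin subr_gt0 ab.
Qed.

End LebesgueAffine.

(** * Euler integrals *)

Section EulerIntegrals.
Variable R : realType.
Local Notation mu := (@lebesgue_measure R).
Implicit Types p q s x : R.

(** The truncated power x_+^(p-1). The test is essential because x `^ r is 1
    for negative x. Defined on the whole line, truncated powers turn the Gamma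
    integral into a Laplace transform and the Beta integral into a convolution,
    and changes of variable need no bookkeeping of domains. *)
Definition pospow p x : R := if 0 < x then x `^ (p - 1) else 0.

Lemma pospow_ge0 p x : 0 <= pospow p x.
Proof. by rewrite /pospow; case: ifP => // _; exact: powR_ge0. Qed.

Lemma pospow_gt0 p x : 0 < x -> 0 < pospow p x.
Proof. by move=> x0; rewrite /pospow x0 powR_gt0. Qed.

Lemma pospowM p s x : 0 < s -> pospow p (s * x) = s `^ (p - 1) * pospow p x.
Proof.
move=> s0; rewrite /pospow pmulr_rgt0//; case: ifP => x0; last by rewrite mulr0.
by rewrite powRM// ltW.
Qed.

Lemma measurable_pospow p : measurable_fun setT (pospow p).
Proof.
apply: measurable_fun_ifT => //.
exact: measurable_fun_ltr.
Qed.

(** Extended real values let Tonelli's theorem yield identities between these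
    integrals before any of them is known to be finite. *)
Definition eGamma p : \bar R := (\int[mu]_x (pospow p x * expR (- x))%:E)%E.
Definition eBeta p q : \bar R := (\int[mu]_x (pospow p x * pospow q (1 - x))%:E)%E.

Lemma measurable_gamma_integrand p :
  measurable_fun setT (fun x : measurableTypeR R => (pospow p x * expR (- x))%:E).
Proof.
apply/measurable_EFinP/measurable_funM; first exact: measurable_pospow.
by apply: (measurableT_comp (@measurable_expR R)).
Qed.

Lemma eGamma_ge0 p : (0 <= eGamma p)%E.
Proof.
by apply: integral_ge0 => x _; rewrite lee_fin mulr_ge0// ?pospow_ge0 ?expR_ge0.
Qed.

Lemma eBeta_ge0 p q : (0 <= eBeta p q)%E.
Proof.
by apply: integral_ge0 => x _; rewrite lee_fin mulr_ge0// ?pospow_ge0.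
Qed.

Lemma measurable_pospow_convol p q s :
  measurable_fun setT (fun x : measurableTypeR R => pospow p x * pospow q (s - x)).
Proof.
apply: measurable_funM; first exact: measurable_pospow.
apply: (measurableT_comp (measurable_pospow q)).
exact: measurable_funB.
Qed.

(** Scaling by s: truncated powers are homogeneous, hence so is their
    convolution, and its value at s = 1 is the Beta integral. *)
Lemma integral_pospow_convol p q s :
  (\int[mu]_x (pospow p x * pospow q (s - x))%:E = (pospow (p + q) s)%:E * eBeta p q)%E.
Proof.
have [s0|s0] := ltP 0 s; last first.
  rewrite {3}/pospow ltNge s0/= mul0e.
  apply: integral0_eq => x _; rewrite /pospow subr_gt0.
  case: ifP => x0; rewrite ?mul0r//.
  by rewrite ltNge (ltW (le_lt_trans s0 x0)) mulr0.
rewrite [LHS](@ge0_integral_affine R s 0); last 3 first.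
- exact: s0.
- by apply/measurable_EFinP; exact: measurable_pospow_convol.
- by move=> x; rewrite lee_fin mulr_ge0// pospow_ge0.
under eq_integral.
  move=> x _; rewrite addr0 -{2}(mulr1 s) -mulrBr !pospowM// mulrACA EFinM.
  over.
rewrite ge0_integralZl_EFin//; first last.
- by rewrite mulr_ge0// powR_ge0.
- by apply/measurable_EFinP; exact: measurable_pospow_convol.
- by move=> x _; rewrite lee_fin mulr_ge0// pospow_ge0.
rewrite muleA -EFinM /pospow s0; congr (_%:E * _)%E.
rewrite -gt0_powRD// -{1}(powRr1 (ltW s0)) -gt0_powRD//.
by congr (_ `^ _); ring.
Qed.

(** By Tonelli the left-hand side is the integral of exp(-s) against the
    convolution of the two truncated powers, which [integral_pospow_convol]
    computes. *)
Lemma eGammaM p q : (eGamma p * eGamma q = eBeta p q * eGamma (p + q))%E.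
Proof.
have mg := measurable_gamma_integrand.
rewrite {1}/eGamma -ge0_integralZr//; last 2 first.
- by move=> x _; rewrite lee_fin mulr_ge0// ?pospow_ge0 ?expR_ge0.
- exact: eGamma_ge0.
pose h (z : measurableTypeR R * measurableTypeR R) : \bar R :=
  (pospow p z.1 * pospow q (z.2 - z.1) * expR (- z.2))%:E.
transitivity (\int[mu]_x \int[mu]_y h (x, y))%E.
  apply: eq_integral => x _.
  rewrite /eGamma (@ge0_integral_affine R 1 (- x))//; last first.
    by move=> y; rewrite lee_fin mulr_ge0// ?pospow_ge0 ?expR_ge0.
  rewrite mul1e -ge0_integralZl_EFin//; first last.
  - by rewrite mulr_ge0// ?pospow_ge0 ?expR_ge0.
  - apply: (measurableT_comp (mg q)).
    by apply: measurable_funD => //; apply: measurable_funM.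
  - by move=> y _; rewrite lee_fin mulr_ge0// ?pospow_ge0 ?expR_ge0.
  apply: eq_integral => y _; rewrite mul1r -EFinM/=; congr (_%:E).
  rewrite /h/= mulrACA -expRD; congr (_ * expR _).
  by rewrite opprB addKr.
rewrite (@fubini_tonelli _ _ _ _ _ mu mu h); first last.
- by move=> z; rewrite lee_fin !mulr_ge0// ?pospow_ge0 ?expR_ge0.
- apply/measurable_EFinP/measurable_funM; first apply: measurable_funM.
  + exact: (measurableT_comp (measurable_pospow p)).
  + apply: (measurableT_comp (measurable_pospow q)).
    exact: measurable_funB.
  + apply: (measurableT_comp (@measurable_expR R)).
    exact: (measurableT_comp (@oppr_measurable _ setT)).
rewrite muleC /eGamma -ge0_integralZr//; last 2 first.
- by move=> x _; rewrite lee_fin mulr_ge0// ?pospow_ge0 ?expR_ge0.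
- exact: eBeta_ge0.
apply: eq_integral => s _ /=.
rewrite /h/=; under eq_integral do rewrite mulrC EFinM.
rewrite ge0_integralZl_EFin; last 4 first.
- exact: measurableT.
- by move=> x _; rewrite lee_fin mulr_ge0// pospow_ge0.
- by apply/measurable_EFinP; exact: measurable_pospow_convol.
- exact: expR_ge0.
rewrite integral_pospow_convol muleA -EFinM; congr (_%:E * _)%E; exact: mulrC.
Qed.

Lemma eGamma1 : eGamma 1 = 1%E.
Proof.
rewrite -(@integral_exponential_pdf R 1 ltr01) /exponential_pdf.
transitivity (\int[mu]_(x in `]0%R, +oo[) (expR (- x))%:E)%E.
  rewrite [RHS]integral_mkcond; apply: eq_integral => x _.
  rewrite /pospow patchE subrr powRr0.
  have -> : (x \in `]0, +oo[%classic) = (0 < x).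
    by apply/idP/idP; rewrite inE/= in_itv/= andbT.
  by case: ifP => _; rewrite ?mul1r ?mul0r.
rewrite integral_itv_obnd_cbnd; last first.
  apply: measurable_funTS; apply/measurable_EFinP.
  by apply: (measurableT_comp (@measurable_expR R)).
rewrite [LHS]integral_mkcond; apply: eq_integral => x _.
by rewrite !patchE; case: ifP => // _; rewrite mul1r mulN1r.
Qed.

(** For p < 1 the integrand is unbounded at 0, so the fundamental theorem of
    calculus is applied on [1/(n+2), 1] and the domain increases to ]0, 1]. *)
Lemma integral_powR01 p : 0 < p ->
  (\int[mu]_(x in `]0%R, 1%R]) (x `^ (p - 1))%:E)%E = (p^-1)%:E.
Proof.
move=> p0; pose F (n : nat) : set (measurableTypeR R) := `[(n.+2%:R^-1 : R), 1%R]%classic.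
have F0 n : 0 < (n.+2%:R^-1 : R) by [].
have F1 n : (n.+2%:R^-1 : R) < 1.
  by rewrite invf_lt1// ltr1n.
have -> : (`]0%R, 1%R]%classic : set R) = \bigcup_n F n.
  apply/seteqP; split => x /=.
    rewrite in_itv/= => /andP[x0 x1].
    exists (Num.truncn x^-1) => //; rewrite /F/= in_itv/= x1 andbT.
    rewrite -[leRHS]invrK lef_pV2 ?posrE ?invr_gt0//.
    apply/ltW/(lt_trans (truncnS_gt _)); by rewrite ltr_nat.
  move=> [n _]; rewrite /F/= !in_itv/= => /andP[h ->].
  by rewrite (lt_le_trans (F0 n) h).
have mF n : measurable (F n) by exact: measurable_itv.
have mf n : measurable_fun (F n) (fun x : measurableTypeR R => (x `^ (p - 1))%:E).
  by apply/measurable_EFinP; apply: measurable_funTS; exact: measurable_powR.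
have ndF : {homo F : n m / (n <= m)%N >-> (n <= m)%O}.
  move=> m n mn; rewrite subsetEset => x; rewrite /F/= !in_itv/= => /andP[h ->].
  by rewrite andbT (le_trans _ h)// lef_pV2 ?posrE// ler_nat !ltnS.
have FD x : 0 < x -> is_derive x 1 (fun x => p^-1 * x `^ p) (p^-1 * (p * x `^ (p - 1))).
  by move=> x0; apply: is_deriveZ; exact: is_derive_powR.
have FC x : 0 < x -> {for x, continuous (fun x => p^-1 * x `^ p)}.
  move=> x0; apply/differentiable_continuous/derivable1_diffP.
  by have [] := FD _ x0.
have H := ge0_nondecreasing_set_cvg_integral (mu := mu) ndF mF mf
  (fun n x _ => powR_ge0 x (p - 1)).
rewrite -(cvg_lim (@ereal_hausdorff R) H); apply/cvg_lim => //.
rewrite (_ : (fun n => _) =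
    (fun n => (p^-1 * 1 `^ p - p^-1 * (n.+2%:R^-1) `^ p)%:E)); last first.
  apply/funext => n; rewrite (@continuous_FTC2 R (fun x => x `^ (p - 1))
    (fun x => p^-1 * x `^ p))//.
  - apply: continuous_in_subspaceT => x; rewrite inE/= in_itv/= => /andP[x0 _].
    apply/differentiable_continuous/derivable1_diffP/derivable_powR.
    by rewrite in_itv/= andbT (lt_le_trans (F0 n)).
  - split.
    + move=> x; rewrite in_itv/= => /andP[x0 _].
      by have [] := FD _ (lt_trans (F0 n) x0).
    + apply: cvg_at_right_filter; exact: FC.
    + apply: cvg_at_left_filter; exact: FC.
  - move=> x; rewrite in_itv/= => /andP[x0 _].
    have x0' := lt_trans (F0 n) x0.
    rewrite derive1E; have [_ ->] := FD _ x0'.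
    by rewrite mulrA mulVf ?gt_eqF// mul1r.
apply: cvg_EFin.
  by near=> n.
rewrite /comp/= powR1 mulr1 -[X in _ --> X]subr0; apply: cvgB; first exact: cvg_cst.
rewrite -(mulr0 p^-1); apply: cvgMr.
have /cvg_at_rightP := powR_cvg0 p0; apply; split => //.
have := @cvg_harmonic R; rewrite -cvg_shiftS; exact.
Unshelve. all: by end_near. Qed.

Lemma eBetap1 p : 0 < p -> eBeta p 1 = (p^-1)%:E.
Proof.
move=> p0; rewrite -integral_powR01// -integral_itv_bndo_bndc; last first.
  by apply: measurable_funTS; apply/measurable_EFinP; exact: measurable_powR.
rewrite [RHS]integral_mkcond; apply: eq_integral => x _.
rewrite patchE /pospow subrr powRr0 subr_gt0.
have -> : (x \in `]0, 1[%classic) = (0 < x < 1).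
  by apply/idP/idP; rewrite inE/= in_itv/=.
by case: (0 < x); case: (x < 1); rewrite ?mulr1 ?mul0r ?mulr0.
Qed.

(** The product formula [eGammaM] at q = 1, where B(p, 1) = 1 / p. *)
Lemma eGammaS p : 0 < p -> eGamma (p + 1) = (p%:E * eGamma p)%E.
Proof.
move=> p0; have := eGammaM p 1; rewrite eGamma1 mule1 eBetap1// => ->.
by rewrite muleA -EFinM divff ?gt_eqF// mul1e.
Qed.

Lemma eGamma_nat n : (eGamma n.+1%:R < +oo)%E.
Proof.
elim: n => [|n IH]; first by rewrite eGamma1 ltry.
by rewrite -natr1 eGammaS// lte_mul_pinfty// ?lee_fin// eGamma_ge0.
Qed.

(** For p >= 1, x^(p-1) <= 1 + x^N for an integer N, and Gamma is finite at the
    positive integers; for p < 1 the recurrence reduces p to p + 1. *)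
Lemma eGamma_lty p : 0 < p -> (eGamma p < +oo)%E.
Proof.
suff H q : 1 <= q -> (eGamma q < +oo)%E.
  move=> p0; have := H (p + 1); rewrite lerDr ltW// => /(_ isT).
  rewrite eGammaS//; have := eGamma_ge0 p; case: (eGamma p) => [r _ _|_|//]; first exact: ltry.
  by rewrite gt0_muley ?lte_fin.
move=> q1.
have n0 : 0 <= q - 1 by rewrite subr_ge0.
apply: (@le_lt_trans _ _ (eGamma 1 + eGamma (Num.truncn q).+1%:R)%E); last first.
  by apply: lte_add_pinfty; [rewrite eGamma1 ltry|exact: eGamma_nat].
rewrite /eGamma -ge0_integralD//; first last.
- exact: measurable_gamma_integrand.
- by move=> x _; rewrite lee_fin mulr_ge0// ?pospow_ge0 ?expR_ge0.
- exact: measurable_gamma_integrand.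
- by move=> x _; rewrite lee_fin mulr_ge0// ?pospow_ge0 ?expR_ge0.
apply: ge0_le_integral => //.
- by move=> x _; rewrite lee_fin mulr_ge0// ?pospow_ge0 ?expR_ge0.
- exact: measurable_gamma_integrand.
- by apply: emeasurable_funD; exact: measurable_gamma_integrand.
move=> x _; rewrite -EFinD lee_fin -mulrDl ler_pM2r ?expR_gt0//.
rewrite /pospow; case: ifP => x0; last by rewrite addr0.
rewrite subrr powRr0; have [x1|x1] := leP x 1.
  rewrite -[leLHS]addr0 lerD ?powR_ge0//.
  by rewrite -[leRHS](powRr0 x) ger_powR ?x0.
rewrite -[leLHS]add0r lerD// ler_powR ?(ltW x1)// lerD2r.
exact/ltW/truncnS_gt.
Qed.

Lemma eGamma_gt0 p : (0 < eGamma p)%E.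
Proof.
apply: (@integral_itv_gt0 R 0 1) => //.
- exact: measurable_gamma_integrand.
- by move=> x; rewrite lee_fin mulr_ge0// ?pospow_ge0 ?expR_ge0.
- by move=> x /andP[x0 _]; rewrite lte_fin mulr_gt0 ?pospow_gt0// expR_gt0.
Qed.

Lemma eBeta_gt0 p q : (0 < eBeta p q)%E.
Proof.
apply: (@integral_itv_gt0 R 0 1) => //.
- by apply/measurable_EFinP; exact: measurable_pospow_convol.
- by move=> x; rewrite lee_fin mulr_ge0// ?pospow_ge0.
- by move=> x /andP[x0 x1]; rewrite lte_fin mulr_gt0 ?pospow_gt0// subr_gt0.
Qed.

(** In the product formula the other factors are positive and finite. *)
Lemma eBeta_lty p q : 0 < p -> 0 < q -> (eBeta p q < +oo)%E.
Proof.
move=> p0 q0; have := eGammaM p q.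
have : (eGamma p * eGamma q < +oo)%E.
  have := eGamma_lty p0; have := eGamma_lty q0.
  have := eGamma_ge0 p; have := eGamma_ge0 q.
  by case: (eGamma p) => // x; case: (eGamma q) => // y _ _ _ _; rewrite -EFinM ltry.
move=> + E; rewrite {}E; have := eBeta_ge0 p q; have := eGamma_gt0 (p + q).
move: (eBeta p q) (eGamma (p + q)) => [r|//|//] b b0 _; first by rewrite ltry.
by rewrite gt0_mulye.
Qed.

(** On ]0, 1[ the power x^(p-1) decreases strictly in p; the difference of the
    integrands then has positive integral by [integral_itv_gt0]. *)
Lemma eBeta_lt p p' q : 0 < p -> p < p' -> 0 < q -> (eBeta p' q < eBeta p q)%E.
Proof.
move=> p0 pp' q0.
have p'0 := lt_trans p0 pp'.
have lt_pospow x : 0 < x < 1 -> pospow p' x < pospow p x.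
  move=> /andP[x0 x1]; rewrite /pospow x0.
  rewrite -(subrK p p') -addrA (gt0_powRD (p' - p) (p - 1))// -[ltRHS]mul1r.
  rewrite ltr_pM2r ?powR_gt0//.
  have := @gt0_ltr_powR R (p' - p); rewrite subr_gt0 => /(_ pp').
  move=> /(_ x 1); rewrite powR1; apply => //; rewrite nnegrE//; exact: ltW.
have ge0 x : (0 <= (pospow p x - pospow p' x) * pospow q (1 - x)).
  have [x01|] := boolP (0 < x < 1).
    by rewrite mulr_ge0 ?pospow_ge0// subr_ge0 ltW// lt_pospow.
  rewrite negb_and; case: (ltP 0 x) => //= x0; last first.
    by rewrite /pospow ltNge x0/= subrr mul0r.
  by move=> x1; rewrite /pospow subr_gt0 (negbTE x1) mulr0.
have mh : measurable_fun setT (fun x : measurableTypeR R =>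
    ((pospow p x - pospow p' x) * pospow q (1 - x))%:E).
  apply/measurable_EFinP; under eq_fun do rewrite mulrBl.
  by apply: measurable_funB; exact: measurable_pospow_convol.
have -> : eBeta p q = (eBeta p' q +
    \int[mu]_x ((pospow p x - pospow p' x) * pospow q (1 - x))%:E)%E.
  rewrite /eBeta -ge0_integralD//; first last.
  - by move=> x _; rewrite lee_fin.
  - by apply/measurable_EFinP; exact: measurable_pospow_convol.
  - by move=> x _; rewrite lee_fin mulr_ge0// pospow_ge0.
  by apply: eq_integral => x _; rewrite -EFinD -mulrDl [pospow p' x + _]addrC subrK.
rewrite lteDl; last by rewrite ge0_fin_numE ?eBeta_ge0 ?eBeta_lty.
apply: (@integral_itv_gt0 R 0 1) => // x x01.
by rewrite lte_fin mulr_gt0 ?subr_gt0 ?lt_pospow ?pospow_gt0 ?subr_gt0//; case/andP: x01.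
Qed.

Lemma Euler_integralE p : Euler_integral p = fine (eGamma p).
Proof.
rewrite /Euler_integral /Rintegral; congr fine.
rewrite integral_mkcond /eGamma; apply: eq_integral => x _.
rewrite patchE /pospow.
have -> : (x \in `]0, +oo[%classic) = (0 < x).
  by apply/idP/idP; rewrite inE/= in_itv/= andbT.
by case: ifP => // _; rewrite mul0r.
Qed.

End EulerIntegrals.

Opaque eGamma eBeta.

(** * The function rho *)

Section GammaRho.
Variable R : realType.
Implicit Types p q s t x a : R.

Definition Beta p q : R := fine (eBeta p q).

Lemma BetaE p q : 0 < p -> 0 < q -> eBeta p q = (Beta p q)%:E.
Proof.
by move=> p0 q0; rewrite /Beta fineK// ge0_fin_numE ?eBeta_ge0// eBeta_lty.
Qed.

Lemma Beta_gt0 p q : 0 < p -> 0 < q -> 0 < Beta p q.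
Proof. by move=> p0 q0; rewrite -lte_fin -BetaE// eBeta_gt0. Qed.

Lemma Beta_lt p p' q : 0 < p -> p < p' -> 0 < q -> Beta p' q < Beta p q.
Proof.
move=> p0 pp' q0; rewrite -lte_fin -!BetaE ?eBeta_lt//.
exact: lt_trans pp'.
Qed.

Lemma GammaE p : 0 < p -> eGamma p = (Gamma p)%:E.
Proof.
move=> p0; rewrite /Gamma p0 Euler_integralE fineK//.
by rewrite ge0_fin_numE ?eGamma_ge0// eGamma_lty.
Qed.

Lemma Gamma_gt0 p : 0 < p -> 0 < Gamma p.
Proof. by move=> p0; rewrite -lte_fin -GammaE// eGamma_gt0. Qed.

Lemma Gamma_neq0 p : 0 < p -> Gamma p != 0.
Proof. by move=> p0; rewrite gt_eqF// Gamma_gt0. Qed.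

(** For -1 < p < 0 this is the definition of Gamma, with one factor in the
    denominator. *)
Lemma GammaS p : -1 < p -> p != 0 -> Gamma (p + 1) = p * Gamma p.
Proof.
move=> p1 pn0; have p10 : 0 < p + 1 by lra.
have [p0|p0] := ltP 0 p.
  by apply: EFin_inj; rewrite EFinM -!GammaE// eGammaS.
rewrite {2}/Gamma ltNge p0/=.
have -> : Num.truncn (- p) = 0%N.
  by apply: truncn_def; rewrite oppr_ge0 p0/= ltrNl.
rewrite big_ord1 addr0 /Gamma p10; field.
exact: pn0.
Qed.

Lemma Gamma0 : Gamma (0 : R) = 0.
Proof.
rewrite /Gamma ltxx oppr0 truncn0 big_ord1 addr0.
by rewrite invr0 mulr0.
Qed.

Lemma BetaGamma p q : 0 < p -> 0 < q ->
  Beta p q = Gamma p * Gamma q / Gamma (p + q).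
Proof.
move=> p0 q0; have pq0 : 0 < p + q by rewrite addr_gt0.
apply/eqP; rewrite -subr_eq0 -[Beta p q](@mulfK _ (Gamma (p + q))) ?Gamma_neq0//.
rewrite subr_eq0; apply/eqP; congr (_ / _); apply: EFin_inj.
rewrite !EFinM -(GammaE p0) -(GammaE q0) -(GammaE pq0) -(BetaE p0 q0).
exact/esym/eGammaM.
Qed.

Section Rho.
Variable a : R.
Hypothesis a01 : 0 < a < 1.

(** From B(t+1, 1-a) Gamma(t+2-a) = Gamma(t+1) Gamma(1-a). This formula holds
    on the whole domain and exhibits the sign of rho; for t < a - 1 it gives
    -rho as a product of two positive decreasing factors. *)
Lemma rho_Beta t : -1 < t ->
  rho a t = (t + 1 - a) * Beta (t + 1) (1 - a) / Gamma (1 - a).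
Proof.
have /andP[a0 a1] := a01; have a1' : 0 < 1 - a by lra.
move=> t1; have t10 : 0 < t + 1 by lra.
rewrite BetaGamma// /rho.
have [->|h] := eqVneq (t + 1 - a) 0; first by rewrite Gamma0 invr0 mulr0 !mul0r.
have -> : t + 1 + (1 - a) = t + 1 - a + 1 by ring.
have GS : Gamma (t + 1 - a + 1) = (t + 1 - a) * Gamma (t + 1 - a).
  by apply: GammaS => //; lra.
have : Gamma (t + 1 - a + 1) != 0 by apply: Gamma_neq0; lra.
rewrite GS mulf_eq0 negb_or => /andP[_ G0].
by field; rewrite h G0 Gamma_neq0.
Qed.

(** Where rho is positive, its monotonicity is read off from this second
    formula, whose denominator decreases in t. *)
Lemma rho_BetaV t : a - 1 < t -> rho a t = Gamma a / Beta (t + 1 - a) a.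
Proof.
have /andP[a0 a1] := a01; have a1' : 0 < 1 - a by lra.
move=> t1; have h : 0 < t + 1 - a by lra.
rewrite BetaGamma// subrK /rho; field.
rewrite !Gamma_neq0//; lra.
Qed.

Lemma rho_gt0 t : a - 1 < t -> 0 < rho a t.
Proof.
have /andP[a0 a1] := a01; have a1' : 0 < 1 - a by lra.
by move=> t1; rewrite rho_BetaV// divr_gt0 ?Gamma_gt0// Beta_gt0//; lra.
Qed.

Lemma rho_le0 t : -1 < t -> t <= a - 1 -> rho a t <= 0.
Proof.
have /andP[a0 a1] := a01; have a1' : 0 < 1 - a by lra.
move=> t0 t1; rewrite rho_Beta// -mulrA mulr_le0_ge0//; first by lra.
by rewrite divr_ge0 ?ltW ?Gamma_gt0// Beta_gt0//; lra.
Qed.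

Lemma rho_lt t t' : -1 < t -> t < t' -> rho a t < rho a t'.
Proof.
have /andP[a0 a1] := a01; have a1' : 0 < 1 - a by lra.
move=> t0 tt'; have [at_|ta] := ltP (a - 1) t.
  rewrite !rho_BetaV//; last exact: lt_trans tt'.
  rewrite ltr_pM2l ?Gamma_gt0// ltf_pV2 ?posrE ?Beta_gt0//; try lra.
  by apply: Beta_lt => //; lra.
have [at'|t'a] := ltP (a - 1) t'.
  by rewrite (le_lt_trans (rho_le0 _ _))// rho_gt0.
rewrite !rho_Beta//; last lra.
rewrite ltr_pM2r ?invr_gt0 ?Gamma_gt0// -ltrN2 -!mulNr.
apply: (@le_lt_trans _ _ (- (t' + 1 - a) * Beta (t + 1) (1 - a))).
  rewrite ler_wpM2l//; first by lra.
  by apply/ltW/Beta_lt => //; lra.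
by rewrite ltr_pM2r ?Beta_gt0//; lra.
Qed.

Lemma rho_inj t t' : -1 < t -> -1 < t' -> rho a t = rho a t' -> t = t'.
Proof.
move=> t0 t0' e; case: (ltgtP t t') => // h.
  by have := rho_lt t0 h; rewrite e ltxx.
by have := rho_lt t0' h; rewrite e ltxx.
Qed.

Lemma rho_le t t' : -1 < t -> t <= t' -> rho a t <= rho a t'.
Proof.
by move=> t0; rewrite le_eqVlt => /predU1P[->//|h]; exact/ltW/rho_lt.
Qed.

(** The recurrence of Gamma, transported to rho; it controls rho at both ends
    of its domain. *)
Lemma rho_rec t : -1 < t -> (t + 1) * rho a t = (t + 1 - a) * rho a (t + 1).
Proof.
have /andP[a0 a1] := a01; have a1' : 0 < 1 - a by lra.
move=> t1; have t10 : 0 < t + 1 by lra.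
rewrite /rho.
have [->|h] := eqVneq (t + 1 - a) 0; first by rewrite Gamma0 invr0 !mulr0 mul0r.
have -> : t + 1 + 1 - a = t + 1 - a + 1 by ring.
have GS : Gamma (t + 1 - a + 1) = (t + 1 - a) * Gamma (t + 1 - a).
  by apply: GammaS => //; lra.
have GS' : Gamma (t + 1 + 1) = (t + 1) * Gamma (t + 1).
  by apply: GammaS; [lra|rewrite gt_eqF].
have : Gamma (t + 1 - a + 1) != 0 by apply: Gamma_neq0; lra.
rewrite GS GS' mulf_eq0 negb_or => /andP[_ G0].
by field; rewrite h G0.
Qed.

Let h p := Beta p (1 - a).

(** p |-> B(p, 1-a) decreases, while p B(p, 1-a) = Gamma(1-a) rho(p) increases.
    So the relative variation of B is at most that of p, which makes B
    continuous. *)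
Lemma Beta_squeeze p p' : 0 < p -> p <= p' -> h p' <= h p /\ p * h p <= p' * h p'.
Proof.
have /andP[a0 a1] := a01; have a1' : 0 < 1 - a by lra.
move=> p0 pp'; have p'0 : 0 < p' by lra.
have E x : 0 < x -> x * h x = Gamma (1 - a) * rho a x.
  move=> x0; rewrite /h BetaGamma// /rho GammaS ?(gt_eqF x0)//; last lra.
  have -> : x + (1 - a) = x + 1 - a by ring.
  by field; apply: Gamma_neq0; lra.
split; last by rewrite !E// ler_pM2l ?Gamma_gt0// rho_le//; lra.
move: pp'; rewrite le_eqVlt => /predU1P[->//|pp'].
by apply/ltW/Beta_lt => //.
Qed.

Lemma continuous_Beta p : 0 < p -> {for p, continuous h}.
Proof.
have /andP[a0 a1] := a01; have a1' : 0 < 1 - a by lra.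
move=> p0.
have H0 : `|p / x - 1| * h p @[x --> p] --> 0.
  have : p / x - 1 @[x --> p] --> p / p - 1.
    apply: cvgB; last exact: cvg_cst.
    by apply: cvgMr; apply: cvgV; [exact: lt0r_neq0|exact: cvg_id].
  rewrite divff ?gt_eqF// subrr => /cvg_norm; rewrite normr0 => H.
  by rewrite -(mul0r (h p)); exact: cvgMl.
have H1 : h p - `|p / x - 1| * h p @[x --> p] --> h p.
  by rewrite -[X in _ --> X]subr0; apply: cvgB => //; exact: cvg_cst.
have H2 : h p + `|p / x - 1| * h p @[x --> p] --> h p.
  by rewrite -[X in _ --> X]addr0; apply: cvgD => //; exact: cvg_cst.
apply: (squeeze_cvgr _ H1 H2); near=> x.
have x0 : 0 < x by near: x; exact: lt_nbhsr.
have hp0 : 0 < h p by exact: Beta_gt0.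
have E : p / x * h p = (p * h p) / x by ring.
have [xp|px] := leP x p.
  have [g1 g2] := Beta_squeeze x0 xp.
  have px1 : 1 <= p / x by rewrite ler_pdivlMr// mul1r.
  rewrite ger0_norm ?subr_ge0// mulrBl mul1r.
  have : h x <= p / x * h p by rewrite E ler_pdivlMr// mulrC.
  move: (p / x * h p) (h p) (h x) g1 => u v w; clear; lra.
have [g1 g2] := Beta_squeeze p0 (ltW px).
have px1 : p / x <= 1 by rewrite ler_pdivrMr// mul1r ltW.
rewrite ler0_norm ?subr_le0// opprB mulrBl mul1r.
have : p / x * h p <= h x by rewrite E ler_pdivrMr// [h x * _]mulrC.
move: (p / x * h p) (h p) (h x) g1 => u v w; clear; lra.
Unshelve. all: by end_near. Qed.

Lemma continuous_rho t : -1 < t -> {for t, continuous (rho a)}.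
Proof.
move=> t1.
have : {for t, continuous (fun s => (s + 1 - a) * h (s + 1) / Gamma (1 - a))}.
  apply: cvgMl; apply: cvgM.
    by apply: cvgB; [apply: cvgD; [exact: cvg_id|exact: cvg_cst]|exact: cvg_cst].
  apply: (@cvg_comp _ _ _ (fun s => s + 1) h _ (nbhs (t + 1))).
    by apply: cvgD; [exact: cvg_id|exact: cvg_cst].
  by apply: continuous_Beta; lra.
rewrite /prop_for /continuous_at -rho_Beta//.
apply: cvg_trans; apply: near_eq_cvg.
near=> s; apply/esym/rho_Beta.
by near: s; exact: lt_nbhsr.
Unshelve. all: by end_near. Qed.

(** By [rho_rec], rho(n+1) - rho(n) = a rho(n+1) / (n+1) >= a rho(0) / (n+1):
    the divergence of the harmonic series sends rho to infinity. *)
Lemma rho_nat n : rho a 0 * a * series harmonic n <= rho a n%:R.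
Proof.
have /andP[a0 a1] := a01; have a1' : 0 < 1 - a by lra.
have rho0 : 0 < rho a 0 by apply: rho_gt0; lra.
elim: n => [|n IH]; first by rewrite /series/= big_geq// mulr0; exact/ltW.
rewrite seriesSr mulrDr.
have n0 : -1 < n%:R :> R by rewrite (lt_le_trans _ (ler0n _ n))//; lra.
have n0' : 0 < n%:R + 1 :> R by lra.
have n1 : (n%:R + 1 : R) != 0 by rewrite gt_eqF.
have E : rho a n%:R = rho a n.+1%:R - a * rho a n.+1%:R / (n%:R + 1).
  by apply: (mulfI n1); rewrite rho_rec// -natr1; field.
have r0 : rho a 0 <= rho a n.+1%:R by rewrite rho_le//; lra.
have -> : harmonic n = (n%:R + 1 : R)^-1 by rewrite /harmonic natr1.
have : rho a 0 * a / (n%:R + 1) <= a * rho a n.+1%:R / (n%:R + 1).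
  by rewrite ler_pM2r ?invr_gt0// mulrC ler_pM2l.
move: IH; rewrite E => h1 h2; have := lerD h1 h2; rewrite subrK.
exact.
Qed.

Lemma rho_large M : exists2 T, 0 <= T & forall t, T <= t -> M <= rho a t.
Proof.
have /andP[a0 a1] := a01; have a1' : 0 < 1 - a by lra.
have rho0 : 0 < rho a 0 by apply: rho_gt0; lra.
have [n hn] : exists n : nat, M <= rho a 0 * a * series harmonic n.
  have : series (@harmonic R) n @[n --> \oo] --> +oo.
    apply: nondecreasing_dvgn_lt; last exact: dvg_harmonic.
    by apply: nondecreasing_series => k _ _; exact: harmonic_ge0.
  move=> /cvgryPge /(_ (M / (rho a 0 * a)))[n _ /(_ n (leqnn n))/= hn].
  by exists n; rewrite mulrC -ler_pdivrMr// mulr_gt0.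
exists n%:R => // t nt; apply: (le_trans hn); apply: (le_trans (rho_nat n)).
by rewrite rho_le// (lt_le_trans _ (ler0n _ n)).
Qed.

(** By [rho_rec], rho(e-1) = (1 - a/e) rho(e) <= (1 - a/e) rho(0) for
    0 < e <= a, and the right-hand side tends to -oo as e tends to 0. *)
Lemma rho_small l : exists2 t, -1 < t < 0 & rho a t <= l.
Proof.
have /andP[a0 a1] := a01; have a1' : 0 < 1 - a by lra.
have rho0 : 0 < rho a 0 by apply: rho_gt0; lra.
(* e is chosen so that (a / e - 1) * rho a 0 = |l| *)
pose e := a / (1 + `|l| / rho a 0).
have d1 : 1 <= 1 + `|l| / rho a 0 by rewrite lerDl divr_ge0 ?(ltW rho0).
have d0 : 0 < 1 + `|l| / rho a 0 by lra.
have e0 : 0 < e by rewrite divr_gt0.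
have ea : e <= a by rewrite ler_pdivrMr// ler_peMr// ltW.
exists (e - 1); first by apply/andP; split; lra.
have := @rho_rec (e - 1); rewrite subrK => /(_ _)-H.
have E : rho a (e - 1) = (1 - a / e) * rho a e.
  apply: (@mulfI _ e); first by rewrite gt_eqF.
  rewrite H; last lra.
  by field; rewrite gt_eqF.
rewrite E; have -> : a / e = 1 + `|l| / rho a 0.
  by rewrite /e invf_div mulrC divfK ?gt_eqF.
have -> : (1 - (1 + `|l| / rho a 0)) = - (`|l| / rho a 0) by ring.
rewrite mulNr lerNl (@le_trans _ _ `|l|)//; first by rewrite lerNl lerNnormlW.
rewrite mulrAC ler_pdivlMr// ler_wpM2l// rho_le//; lra.
Qed.

Lemma rho_surj l : exists2 t, -1 < t & rho a t = l.
Proof.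
have [t1 /andP[h1 h2] r1] := rho_small l.
have [t2 h3 r2] := rho_large l.
have t12 : t1 <= t2 by lra.
have [||c + <-] := @IVT _ (rho a) _ _ l t12.
- apply: continuous_in_subspaceT => x; rewrite inE/= in_itv/= => /andP[x1 _].
  by apply: continuous_rho; lra.
- by rewrite ge_min r1 le_max (r2 t2)// orbT.
by rewrite in_itv/= => /andP[x1 _]; exists c => //; lra.
Qed.

Lemma rho_invP l : -1 < rho_inv a l /\ rho a (rho_inv a l) = l.
Proof.
have [t t1 tl] := rho_surj l.
have := @xgetPex _ 0 [set x | -1 < x /\ rho a x = l]; apply.
by exists t.
Qed.

(** Since rho tends to infinity, the difference is at least 1 for all but
    finitely many k. *)
Lemma rho_sub_inv_bounded g l : -1 < g ->
  (forall k, (0 < k)%N -> rho a (a * k%:R + g) != l) ->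
  exists2 D, 0 <= D &
    forall k, (0 < k)%N -> `|rho a (a * k%:R + g) - l|^-1 <= D.
Proof.
have /andP[a0 a1] := a01.
move=> g1 neq; have [T T0 HT] := rho_large (l + 1).
pose x k := `|rho a (a * k%:R + g) - l|^-1.
have x0 k : 0 <= x k by rewrite invr_ge0.
pose N := (Num.truncn ((T - g) / a)).+1.
exists (1 + \sum_(k < N) x k); first by rewrite addr_ge0// sumr_ge0.
move=> k k0; rewrite -/(x k).
have [kN|Nk] := ltnP k N.
  rewrite (bigD1 (Ordinal kN))//= addrCA lerDl addr_ge0// sumr_ge0//.
rewrite -[leLHS]addr0 lerD ?sumr_ge0// /x.
have Tk : T <= a * k%:R + g.
  rewrite -lerBlDr mulrC -ler_pdivrMr//.
  by rewrite ltW// (lt_le_trans (truncnS_gt _))// ler_nat.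
have h1 : 1 <= rho a (a * k%:R + g) - l by have := HT _ Tk; lra.
rewrite invf_le1; first by rewrite (le_trans h1)// ler_norm.
by rewrite normr_gt0; apply/eqP => e; move: h1; rewrite e; lra.
Qed.

End Rho.
End GammaRho.

(** * Power series with geometrically bounded coefficients *)

Section GeometricGrowth.
Variable R : realType.
Implicit Types (c d : nat -> R) (x y C K : R).

(** A quantitative form of a positive radius of convergence, chosen because it
    passes through recursions and formal differentiation. *)
Definition geom_bounded C K c := forall k, `|c k| <= C * K ^+ k.

Lemma geom_bounded_ge0 C K c : geom_bounded C K c -> 0 <= C.
Proof. by move=> /(_ 0); rewrite expr0 mulr1; exact: le_trans. Qed.

Lemma geom_bounded_term C K c x y k : 0 <= K -> geom_bounded C K c -> `|x| <= y ->
  `|c k * x ^+ k| <= C * (y * K) ^+ k.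
Proof.
move=> K0 gc xy; rewrite normrM normrX exprMn [y ^+ k * _]mulrC mulrA.
rewrite ler_pM ?exprn_ge0// lerXn2r// nnegrE.
exact: le_trans xy.
Qed.

Lemma is_cvg_pseries_geom C K c x : 0 <= K -> geom_bounded C K c -> `|x| * K < 1 ->
  cvgn (pseries c x).
Proof.
move=> K0 gc xK; apply: normed_cvg.
apply: (@series_le_cvg _ _ (geometric C (`|x| * K))).
- by move=> n; exact: normr_ge0.
- by move=> n; rewrite /geometric/= mulr_ge0 ?(geom_bounded_ge0 gc)// exprn_ge0// mulr_ge0.
- by move=> n; exact: (geom_bounded_term _ K0 gc).
- by apply: is_cvg_geometric_series; rewrite ger0_norm// mulr_ge0.
Qed.

Lemma geom_partial_sum_le C K c x y n :
  0 <= K -> geom_bounded C K c -> `|x| <= y -> y * K < 1 ->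
  `|\sum_(k < n) c k * x ^+ k| <= C / (1 - y * K).
Proof.
move=> K0 gc xy yK.
have y0 : 0 <= y by exact: le_trans xy.
apply: (le_trans (ler_norm_sum _ _ _)).
apply: (@le_trans _ _ (\sum_(k < n) C * (y * K) ^+ k)).
  by apply: ler_sum => k _; exact: (geom_bounded_term _ K0 gc).
have yK1 : y * K != 1 by rewrite lt_eqF.
have := geometric_seriesE C yK1 => /(congr1 (fun f => f n)).
rewrite /series/= big_mkord => ->.
rewrite ler_pM2r ?invr_gt0 ?subr_gt0// ler_piMr ?(geom_bounded_ge0 gc)//.
by rewrite gerBl exprn_ge0// mulr_ge0.
Qed.

(** k + 1 <= 2^k, at the price of halving the radius. *)
Lemma geom_bounded_diffs C K c : 0 <= K -> geom_bounded C K c ->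
  geom_bounded (C * K) (2 * K) (pseries_diffs c).
Proof.
move=> K0 gc k; rewrite /pseries_diffs normrM normr_nat.
apply: (@le_trans _ _ (2 ^+ k * (C * K ^+ k.+1))).
  apply: ler_pM => //.
  by rewrite -natrX ler_nat ltn_expl.
suff -> : C * K * (2 * K) ^+ k = 2 ^+ k * (C * K ^+ k.+1) by [].
by rewrite exprMn exprS; ring.
Qed.

(** Termwise differentiation asks for convergence of the series of second
    derivatives, of growth rate 4 K, at a point beyond x: 1 / (8 K) will do. *)
Lemma is_derive_pseries_geom C K c x : 0 < K -> geom_bounded C K c -> `|x| * (8 * K) < 1 ->
  is_derive x (1 : R) (fun x => limn (pseries c x))
    (limn (pseries (pseries_diffs c) x)).
Proof.
move=> K0 gc xK.
have K00 := ltW K0.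
have K8 : 0 < (8 * K)^-1 by rewrite invr_gt0 mulr_gt0.
have gd := geom_bounded_diffs K00 gc.
have K20 : 0 <= 2 * K by rewrite mulr_ge0.
have gdd := geom_bounded_diffs K20 gd.
have E (m : R) : 0 <= m -> m < 8 -> `|(8 * K)^-1| * (m * K) < 1.
  move=> m0 m8; rewrite gtr0_norm// mulrC -ltr_pdivlMr// invrK mul1r.
  by rewrite ltr_pM2r.
apply: (@pseries_snd_diffs R c (8 * K)^-1).
- by apply: (is_cvg_pseries_geom K00 gc); rewrite -[X in _ * X]mul1r E//; lra.
- by apply: (is_cvg_pseries_geom _ gd) => //; rewrite E//; lra.
- by apply: (is_cvg_pseries_geom _ gdd); [rewrite mulr_ge0|rewrite mulrA E//; lra].
- by rewrite (gtr0_norm K8) -[ltRHS]mul1r ltr_pdivlMr// mulr_gt0.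
Qed.

(** Multiplying the k-th coefficient by q + p k amounts to applying the operator
    q + p x d/dx. *)
Lemma limn_pseries_affine C K c x (p q : R) : 0 <= K -> geom_bounded C K c ->
  `|x| * (2 * K) < 1 ->
  limn (pseries (fun k => (q + p * k%:R) * c k) x) =
  q * limn (pseries c x) + p * x * limn (pseries (pseries_diffs c) x).
Proof.
move=> K0 gc xK.
have K20 : 0 <= 2 * K by rewrite mulr_ge0.
have c1 : cvgn (pseries c x).
  apply: (is_cvg_pseries_geom K0 gc); apply: le_lt_trans xK; rewrite ler_wpM2l//; lra.
have c2 : cvgn (pseries (pseries_diffs c) x).
  exact: (is_cvg_pseries_geom K20 (geom_bounded_diffs K0 gc)).
have c3 := pseries_diffs_equiv c2.
apply/cvg_lim => //.
have -> : pseries (fun k => (q + p * k%:R) * c k) x = (fun n => q * pseries c x n +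
   p * x * series (fun i => i%:R * c i * x ^+ i.-1) n).
  apply/funext => n; rewrite /pseries /series/= !mulr_sumr -big_split/=.
  apply: eq_bigr => -[|k] _ /=; first by rewrite !mulr0 mul0r !mul0r mulr0 !addr0 mulrA.
  by rewrite exprS; ring.
by apply: cvgD; apply: cvgMr.
Qed.

End GeometricGrowth.

(** * Fractional derivatives of generalized power series *)

Section RLpower.
Variable R : realType.
Local Notation mu := (@lebesgue_measure R).
Variable a : R.
Hypothesis a01 : 0 < a < 1.
Implicit Types s d : R.

Lemma measurable_RL_power D s d :
  measurable_fun D (fun x : measurableTypeR R => (RL_kernel a ((@powR R) ^~ d) s x)%:E).
Proof.
apply: measurable_funTS; apply/measurable_EFinP; rewrite /RL_kernel.
apply: measurable_funM; last exact: measurable_powR.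
apply: (measurableT_comp (@measurable_powR R (- a))).
exact: measurable_funB.
Qed.

(** The convolution of two truncated powers, at s. *)
Lemma integral_RL_power s d : 0 < s -> -1 < d ->
  (\int[mu]_(x in `]0%R, s[) (RL_kernel a ((@powR R) ^~ d) s x)%:E =
  (s `^ (d + 1 - a) * Beta (d + 1) (1 - a))%:E)%E.
Proof.
have /andP[a0 a1] := a01.
move=> s0 d1; have := @integral_pospow_convol R (d + 1) (1 - a) s.
rewrite BetaE; [|lra|lra].
rewrite /pospow s0 -EFinM (_ : d + 1 + (1 - a) - 1 = d + 1 - a); last by ring.
move=> <-; rewrite integral_mkcond; apply: eq_integral => x _.
rewrite patchE /RL_kernel.
have -> : (x \in `]0, s[%classic) = (0 < x < s).
  by apply/idP/idP; rewrite inE/= in_itv/=.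
rewrite subr_gt0 addrK; have -> : 1 - a - 1 = - a by ring.
by case: (0 < x); case: (x < s); rewrite ?mulr0 ?mul0r//= mulrC.
Qed.

Lemma integrable_RL_power s d : 0 < s -> -1 < d ->
  mu.-integrable `]0, s[ (fun x => (RL_kernel a ((@powR R) ^~ d) s x)%:E).
Proof.
move=> s0 d1; apply/integrableP; split; first exact: measurable_RL_power.
under eq_integral.
  move=> x _; rewrite gee0_abs; last by rewrite lee_fin mulr_ge0 ?powR_ge0.
  over.
by rewrite integral_RL_power// ltry.
Qed.

Section Series.
Variables (g C K : R) (c : nat -> R).
Hypothesis g1 : -1 < g.
Hypothesis K0 : 0 < K.
Hypothesis gc : geom_bounded C K c.

Let b k : R := Beta (a * k%:R + g + 1) (1 - a).

(** B(., 1-a) decreases, so that its values are at most the first one. *)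
Lemma geom_bounded_Beta : geom_bounded (C * b 0) K (fun k => c k * b k).
Proof.
have /andP[a0 a1] := a01; have g1' := g1; have K0' := K0.
move=> k; rewrite normrM mulrAC.
have bk0 j : 0 < b j.
  by apply: Beta_gt0; last lra; have := mulr_ge0 (ltW a0) (ler0n R j); lra.
rewrite (gtr0_norm (bk0 k)) ler_pM ?(ltW (bk0 _))//.
case: k => // k; apply/ltW/Beta_lt; [lra| |lra].
by rewrite mulr0 !ltrD2r mulr_gt0.
Qed.

Lemma power_split x (k : nat) d : 0 < x ->
  x `^ (a * k%:R + d) = (x `^ a) ^+ k * x `^ d.
Proof.
by move=> x0; rewrite gt0_powRD// powRrM powR_mulrn ?powR_ge0.
Qed.

(** Dominated convergence: on ]0, s[ every partial sum is at most a constant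
    times the leading power x^g, whose kernel integral is finite. *)
Lemma RL_integral_series s f : 0 < s -> s `^ a * K < 1 ->
  (forall x, 0 < x < s -> f x = limn (pseries c (x `^ a)) * x `^ g) ->
  mu.-integrable `]0, s[ (EFin \o RL_kernel a f s) /\
  RL_integral a f s = s `^ (g + 1 - a) * limn (pseries (fun k => c k * b k) (s `^ a)).
Proof.
have /andP[a0 a1] := a01; have g1' := g1; have K0' := K0.
move=> s0 sK fE.
have akg k : -1 < a * k%:R + g by have := mulr_ge0 (ltW a0) (ler0n R k); lra.
pose M := C / (1 - s `^ a * K).
pose F n (x : R) : \bar R := (\sum_(k < n)
  (c k)%:E * (RL_kernel a ((@powR R) ^~ (a * k%:R + g)) s x)%:E)%E.
pose G (x : R) : \bar R := (M%:E * (RL_kernel a ((@powR R) ^~ g) s x)%:E)%E.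
have FE n x : 0 < x -> F n x =
    ((\sum_(k < n) c k * (x `^ a) ^+ k) * RL_kernel a ((@powR R) ^~ g) s x)%:E.
  move=> x0; rewrite /F sumEFin; congr (_%:E); rewrite mulr_suml.
  apply: eq_bigr => k _; rewrite /RL_kernel power_split//; ring.
have mD : measurable (`]0, s[%classic : set (measurableTypeR R)) by exact: measurable_itv.
have mF n : measurable_fun `]0, s[ (F n).
  apply: emeasurable_sum => k; apply: emeasurable_funM; first exact: measurable_cst.
  exact: measurable_RL_power.
have Ff x : `]0, s[%classic x -> F ^~ x @ \oo --> (EFin \o RL_kernel a f s) x.
  rewrite /= in_itv/= => xs; have /andP[x0 xs'] := xs.
  have cx : cvgn (pseries c (x `^ a)).
    apply: (is_cvg_pseries_geom (ltW K0) gc); apply: le_lt_trans sK.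
    by rewrite ler_pM2r// ger0_norm ?powR_ge0// ler_powRl// ltW.
  have -> : F ^~ x = EFin \o (fun n =>
      pseries c (x `^ a) n * RL_kernel a ((@powR R) ^~ g) s x).
    by apply/funext => n; rewrite FE//= /pseries /series/= big_mkord.
  apply: cvg_EFin; first by near=> n.
  have -> : RL_kernel a f s x =
      limn (pseries c (x `^ a)) * RL_kernel a ((@powR R) ^~ g) s x.
    by rewrite /RL_kernel fE//; ring.
  exact: cvgMl.
have mf : measurable_fun `]0, s[ (EFin \o RL_kernel a f s).
  exact: (emeasurable_fun_cvg F _ mF Ff).
have iG : mu.-integrable `]0, s[ G.
  by apply: integrableZl => //; exact: integrable_RL_power.
have FG x n : `]0, s[%classic x -> (`|F n x| <= G x)%E.
  rewrite /= in_itv/= => /andP[x0 xs].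
  have k0 : 0 <= RL_kernel a ((@powR R) ^~ g) s x by rewrite mulr_ge0 ?powR_ge0.
  rewrite FE// /G -EFinM abse_EFin lee_fin normrM (ger0_norm k0) ler_wpM2r//.
  apply: (geom_partial_sum_le _ (ltW K0) gc) => //.
  by rewrite ger0_norm ?powR_ge0// ler_powRl// ltW.
have aeF : {ae mu, forall x, `]0, s[%classic x ->
    F ^~ x @ \oo --> (EFin \o RL_kernel a f s) x}.
  by apply: aeW => x; exact: Ff.
have aeG : {ae mu, forall x n, `]0, s[%classic x -> (`|F n x| <= G x)%E}.
  by apply: aeW => x n; exact: FG.
have [i1 _ i3] := dominated_convergence mD mF mf aeF iG aeG.
split=> //.
rewrite /RL_integral /Rintegral.
have -> // : (\int[mu]_(x in `]0%R, s[) (RL_kernel a f s x)%:E)%E =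
  (s `^ (g + 1 - a) * limn (pseries (fun k => c k * b k) (s `^ a)))%:E.
rewrite -(cvg_lim (@ereal_hausdorff R) i3); apply/cvg_lim => //.
have -> : [sequence (\int[mu]_(x in `]0%R, s[) F n x)%E]_n =
    EFin \o (fun n => s `^ (g + 1 - a) * pseries (fun k => c k * b k) (s `^ a) n).
  apply/funext => n /=; rewrite /F integral_sum//; last first.
    by move=> k; apply: integrableZl => //; exact: integrable_RL_power.
  rewrite /pseries /series/= big_mkord mulr_sumr -sumEFin; apply: eq_bigr => k _.
  rewrite integralZl//; last exact: integrable_RL_power.
  rewrite integral_RL_power// -EFinM; congr (_%:E).
  have -> : a * k%:R + g + 1 - a = a * k%:R + (g + 1 - a) by ring.
  by rewrite power_split// /b; ring.
apply: cvg_EFin; first by near=> n.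
apply: cvgMr; apply: (is_cvg_pseries_geom (ltW K0) geom_bounded_Beta).
by rewrite ger0_norm ?powR_ge0.
Unshelve. all: by end_near. Qed.

(** By [RL_integral_series] the fractional integral of f is s^(g+1-a) P(s^a) with
    P a power series. Differentiating it multiplies the k-th coefficient by
    (a k + g + 1 - a) B(a k + g + 1, 1 - a) = Gamma(1-a) rho(a k + g), which is
    [rho_Beta]. The formula for f is required up to s1 > t because the derivative
    at t involves the integrals over ]0, s[ for all s near t. *)
Lemma RL_derive_series s1 t f : 0 < t < s1 -> s1 `^ a * (8 * K) < 1 ->
  (forall x, 0 < x < s1 -> f x = limn (pseries c (x `^ a)) * x `^ g) ->
  RL_derivable a f t /\
  t `^ a * RL_derive a f t =
    limn (pseries (fun k => rho a (a * k%:R + g) * c k) (t `^ a)) * t `^ g.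
Proof.
have /andP[a0 a1] := a01; have g1' := g1; have K0' := K0.
move=> /andP[t0 ts1] sK fE.
have s10 := lt_trans t0 ts1.
have small s : 0 < s -> s <= s1 -> `|s `^ a| * (8 * K) < 1.
  move=> s0 ss1; apply: le_lt_trans sK; rewrite ler_pM2r ?mulr_gt0//.
  by rewrite ger0_norm ?powR_ge0// ler_powRl// ltW.
have small1 s : 0 < s -> s <= s1 -> s `^ a * K < 1.
  move=> s0 ss1; apply: le_lt_trans (small s s0 ss1).
  rewrite ger0_norm ?powR_ge0// ler_wpM2l ?powR_ge0//; lra.
pose P x := limn (pseries (fun k => c k * b k) x).
pose P' x := limn (pseries (pseries_diffs (fun k => c k * b k)) x).
pose Gf s := s `^ (g + 1 - a) * P (s `^ a).
have near_ok : \forall s \near t, 0 < s /\ s < s1.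
  near=> s; split; near: s; [exact: lt_nbhsr|exact: lt_nbhsl].
have E s : 0 < s -> s < s1 ->
    mu.-integrable `]0, s[ (EFin \o RL_kernel a f s) /\ RL_integral a f s = Gf s.
  move=> s0 ss1; apply: RL_integral_series => //; first by rewrite small1// ltW.
  by move=> x /andP[x0 xs]; rewrite fE// x0 (lt_trans xs).
have dP : is_derive (t `^ a) (1 : R) P (P' (t `^ a)).
  by apply: (is_derive_pseries_geom K0 geom_bounded_Beta); rewrite small// ltW.
have dG : is_derive t (1 : R) Gf
   (t `^ (g + 1 - a) *: (P' (t `^ a) * (a * t `^ (a - 1))) +
    P (t `^ a) *: ((g + 1 - a) * t `^ (g + 1 - a - 1))).
  apply: is_deriveM; first exact: is_derive_powR.
  apply: (@is_derive1_comp R P (fun s => s `^ a)).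
  exact: is_derive_powR.
have dRL : is_derive t (1 : R) (RL_integral a f)
   (t `^ (g + 1 - a) *: (P' (t `^ a) * (a * t `^ (a - 1))) +
    P (t `^ a) *: ((g + 1 - a) * t `^ (g + 1 - a - 1))).
  apply: near_eq_is_derive dG.
  by apply: filterS near_ok => s [s0 ss1]; have [_ ->] := E s s0 ss1.
split.
  split; last by have [] := dRL.
  by apply: filterS near_ok => s [s0 ss1]; have [] := E s s0 ss1.
rewrite /RL_derive derive1E; have [_ ->] := dRL.
have -> : (fun k => rho a (a * k%:R + g) * c k) =
  (fun k => ((g + 1 - a) / Gamma (1 - a) + a / Gamma (1 - a) * k%:R) * (c k * b k)).
  apply/funext => k; rewrite rho_Beta//; last first.
    by have := mulr_ge0 (ltW a0) (ler0n R k); lra.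
  by rewrite /b; ring.
rewrite (limn_pseries_affine _ _ (ltW K0) geom_bounded_Beta); last first.
  apply: le_lt_trans (small t t0 (ltW ts1)); rewrite ler_wpM2l//; lra.
rewrite -/(P _) -/(P' _) /GRing.scale/=.
have -> : t `^ (g + 1 - a) = t `^ g * t `^ (1 - a) by rewrite -gt0_powRD// addrA.
have -> : t `^ (g + 1 - a - 1) = t `^ g * t `^ (- a).
  by rewrite -gt0_powRD//; congr (_ `^ _); ring.
have e1 : t `^ (1 - a) * t `^ (a - 1) = 1.
  by rewrite -gt0_powRD// -(powRr0 t); congr (_ `^ _); ring.
have e2 : t `^ a * t `^ (- a) = 1.
  by rewrite -gt0_powRD// -(powRr0 t); congr (_ `^ _); ring.
transitivity ((Gamma (1 - a))^-1 * t `^ g * (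
   a * t `^ a * P' (t `^ a) * (t `^ (1 - a) * t `^ (a - 1)) +
   (g + 1 - a) * P (t `^ a) * (t `^ a * t `^ (- a)))); first by ring.
by rewrite e1 e2 !mulr1; ring.
Unshelve. all: by end_near. Qed.

End Series.
End RLpower.

(** * Complex series *)

Section ComplexAbs.
Variable R : realType.
Implicit Types z w : R[i].

(** Equivalent to the modulus and submultiplicative, but real-valued and free of
    square roots; a bound on it passes at once to the real and imaginary parts,
    on which the fractional derivative is computed. *)
Definition l1norm z : R := `|complex.Re z| + `|complex.Im z|.

Lemma l1norm_ge0 z : 0 <= l1norm z.
Proof. by rewrite addr_ge0. Qed.

Lemma Re_le_l1norm z : `|complex.Re z| <= l1norm z.
Proof. by rewrite lerDl. Qed.

Lemma Im_le_l1norm z : `|complex.Im z| <= l1norm z.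
Proof. by rewrite lerDr. Qed.

Lemma l1normD z w : l1norm (z + w) <= l1norm z + l1norm w.
Proof.
case: z => a b; case: w => c d; rewrite /l1norm/= addrACA.
by apply: lerD; exact: ler_normD.
Qed.

Lemma l1normM z w : l1norm (z * w) <= l1norm z * l1norm w.
Proof.
case: z => a b; case: w => c d; rewrite /l1norm/=.
apply: (@le_trans _ _ ((`|a| * `|c| + `|b| * `|d|) + (`|a| * `|d| + `|b| * `|c|))).
  rewrite -!normrM; apply: lerD; last exact: ler_normD.
  by rewrite (le_trans (ler_normB _ _)).
suff -> : (`|a| + `|b|) * (`|c| + `|d|) =
  (`|a| * `|c| + `|b| * `|d|) + (`|a| * `|d| + `|b| * `|c|) by [].
by ring.
Qed.

Lemma l1norm0 : l1norm 0 = 0.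
Proof. by rewrite /l1norm/= !normr0 addr0. Qed.

Lemma l1norm_real (x : R) : l1norm x%:C = `|x|.
Proof. by rewrite /l1norm/= normr0 addr0. Qed.

Lemma ReM_real (x : R) z : complex.Re (x%:C * z) = x * complex.Re z.
Proof. by case: z => a b /=; rewrite mul0r subr0. Qed.

Lemma ImM_real (x : R) z : complex.Im (x%:C * z) = x * complex.Im z.
Proof. by case: z => a b /=; rewrite mul0r addr0. Qed.

Lemma l1normM_real (x : R) z : l1norm (x%:C * z) = `|x| * l1norm z.
Proof. by rewrite /l1norm ReM_real ImM_real !normrM mulrDr. Qed.

Lemma l1normX z n : l1norm (z ^+ n) <= l1norm z ^+ n.
Proof.
elim: n => [|n IH]; first by rewrite !expr0 -[1]/(1%:C) l1norm_real normr1.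
by rewrite !exprS (le_trans (l1normM _ _))// ler_wpM2l// l1norm_ge0.
Qed.

Lemma l1norm_sum I (r : seq I) (P : pred I) (F : I -> R[i]) :
  l1norm (\sum_(i <- r | P i) F i) <= \sum_(i <- r | P i) l1norm (F i).
Proof.
elim/big_ind2 : _ => [|x1 x2 y1 y2 h1 h2|//]; first by rewrite l1norm0.
by rewrite (le_trans (l1normD _ _))// lerD.
Qed.

Lemma norm_le_l1norm z : `|z| <= (l1norm z)%:C.
Proof.
case: z => a b; rewrite [X in `|X|]complexE /l1norm/= rmorphD/=.
rewrite (le_trans (ler_normD _ _))// lerD//.
  by rewrite normc_def/= expr0n/= addr0 sqrtr_sqr.
by rewrite normrM !normc_def/= !expr0n/= !expr1n add0r !addr0 sqrtr1 mul1r sqrtr_sqr.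
Qed.

Lemma normc_ge_Im (z : R[i]) : `|complex.Im z|%:C <= `|z|.
Proof.
have := normc_ge_Re (z * 'i%C); rewrite ReiNIm normrN normrM.
by rewrite [`|'i%C|]normc_def/= expr0n/= expr1n add0r sqrtr1 mulr1.
Qed.

Lemma l1norm_le_norm z (e : R) : `|z| <= e%:C -> l1norm z <= 2 * e.
Proof.
move=> ze; have h1 : `|complex.Re z| <= e by rewrite -lecR (le_trans (normc_ge_Re _)).
have h2 : `|complex.Im z| <= e by rewrite -lecR (le_trans (normc_ge_Im _)).
by rewrite /l1norm; lra.
Qed.

Lemma cvg_complex (u : nat -> R[i]^o) (p q : R) :
  (fun n => complex.Re (u n)) @ \oo --> p ->
  (fun n => complex.Im (u n)) @ \oo --> q ->
  u @ \oo --> (p +i* q : R[i]^o).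
Proof.
move=> up uq; apply/(@cvgrPdist_lt _ R[i]^o) => e e0.
have eE : e = (complex.Re e)%:C.
  by rewrite (RRe_real (gtr0_real e0)).
have e'0 : 0 < complex.Re e by move: e0; rewrite eE ltcR.
have e'2 : 0 < complex.Re e / 2 by rewrite divr_gt0.
move/cvgrPdist_lt : up => /(_ _ e'2) up.
move/cvgrPdist_lt : uq => /(_ _ e'2) uq.
near=> n; rewrite eE; apply: (le_lt_trans (norm_le_l1norm _)); rewrite ltcR.
rewrite /l1norm raddfB/= raddfB/= [ltRHS]splitr.
by apply: ltrD; near: n.
Unshelve. all: by end_near. Qed.

Lemma cvg_Re (u : nat -> R[i]^o) (L : R[i]^o) :
  u @ \oo --> L -> (fun n => complex.Re (u n)) @ \oo --> complex.Re L.
Proof.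
move=> /(@cvgrPdist_lt _ R[i]^o) uL; apply/cvgrPdist_lt => e e0.
have e0' : 0 < e%:C by rewrite ltcR.
apply: filterS (uL _ e0') => n; rewrite -raddfB -ltcR.
exact/le_lt_trans/normc_ge_Re.
Qed.

Lemma cvg_Im (u : nat -> R[i]^o) (L : R[i]^o) :
  u @ \oo --> L -> (fun n => complex.Im (u n)) @ \oo --> complex.Im L.
Proof.
move=> /(@cvgrPdist_lt _ R[i]^o) uL; apply/cvgrPdist_lt => e e0.
have e0' : 0 < e%:C by rewrite ltcR.
apply: filterS (uL _ e0') => n; rewrite -raddfB -ltcR.
exact/le_lt_trans/normc_ge_Im.
Qed.

Lemma cvg0_geometric_half (v : nat -> R) (M : R) : (forall n, `|v n| <= M * 2^-1 ^+ n) ->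
  v @ \oo --> (0 : R).
Proof.
move=> vM; have h : geometric M (2^-1) @ \oo --> (0 : R).
  by apply: cvg_geometric; rewrite ger0_norm// invf_lt1// ltr1n.
apply: (@squeeze_cvgr _ _ _ _ (- geometric M 2^-1) (geometric M 2^-1)).
- by near=> n; rewrite -ler_norml.
- by rewrite -[X in _ --> X]oppr0; exact: cvgN.
- exact: h.
Unshelve. all: by end_near. Qed.

Lemma cvg_series_complex (v : nat -> R[i]^o) (C q : R) :
  0 <= q < 1 -> (forall n, l1norm (v n) <= C * q ^+ n) ->
  series v @ \oo --> (limn (series (fun n => complex.Re (v n))) +i*
                      limn (series (fun n => complex.Im (v n))) : R[i]^o).
Proof.
move=> /andP[q0 q1] vC.
have H (f : R[i] -> R) : (forall z, `|f z| <= l1norm z) -> cvgn (series (fun n => f (v n))).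
  move=> fz.
  have -> : series (fun n => f (v n)) = pseries (fun n => f (v n)) 1.
    by rewrite /pseries; congr series; apply/funext => n /=; rewrite expr1n mulr1.
  apply: (@is_cvg_pseries_geom R C q) => //; last by rewrite normr1 mul1r.
  by move=> n; rewrite (le_trans (fz _)).
apply: cvg_complex.
  have -> : (fun n => complex.Re (series v n)) = series (fun n => complex.Re (v n)).
    by apply/funext => n; rewrite /series/= raddf_sum.
  exact: (H _ Re_le_l1norm).
have -> : (fun n => complex.Im (series v n)) = series (fun n => complex.Im (v n)).
  by apply/funext => n; rewrite /series/= raddf_sum.
exact: (H _ Im_le_l1norm).
Qed.

(** Summation over the triangle m + l < N by diagonals and by columns. *)
Lemma cauchy_product_partial (T : comNzRingType) (u v : nat -> T) N :
  \sum_(k < N) \sum_(m < k.+1) u m * v (k - m)%N =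
  \sum_(m < N) u m * \sum_(l < N - m) v l.
Proof.
elim: N => [|N IH]; first by rewrite !big_ord0.
rewrite big_ord_recr/= IH [in RHS]big_ord_recr/= subSnn.
rewrite [X in _ + X]big_ord_recr/= addrA subnn big_ord1; congr (_ + _).
rewrite -big_split/=; apply: eq_bigr => m _.
by rewrite subSn ?(ltnW (ltn_ord m))// big_ord_recr/= mulrDr.
Qed.

(** The product of the N-th partial sums and the N-th partial sum of the product
    series differ by the sum over m < N of u_m times a section of v starting at
    N - m, hence by at most 2 C^2 N / 4^N <= 2 C^2 / 2^N. The ratio 1/4 is small
    enough for this crude estimate to tend to 0. *)
Lemma cauchy_product (u v : nat -> R[i]^o) (C : R) :
  (forall n, l1norm (u n) <= C * 4^-1 ^+ n) -> (forall n, l1norm (v n) <= C * 4^-1 ^+ n) ->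
  series (fun k => \sum_(m < k.+1) u m * v (k - m)%N : R[i]^o) @ \oo -->
    (limn (series u) * limn (series v) : R[i]^o).
Proof.
move=> uC vC.
have C0 : 0 <= C by have := uC 0; rewrite expr0 mulr1; apply: le_trans; exact: l1norm_ge0.
have q01 : 0 <= (4^-1 : R) < 1 by apply/andP; split; lra.
have cu := cvg_series_complex q01 uC.
have cv := cvg_series_complex q01 vC.
have -> : limn (series u) * limn (series v) =
  limn (series u) * limn (series v) - 0 by rewrite subr0.
pose w N := series u N * series v N - series (fun k => \sum_(m < k.+1) u m * v (k - m)%N) N.
have -> : series (fun k => \sum_(m < k.+1) u m * v (k - m)%N) =
  (fun N => series u N * series v N - w N) :> (nat -> R[i]^o).
  by apply/funext => N; rewrite /w opprB addrCA subrr addr0.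
apply: (@cvgB _ R[i]^o).
  have cu' : cvgn (series u) := cvgP _ cu.
  have cv' : cvgn (series v) := cvgP _ cv.
  exact: (@cvgM R[i] nat _ _ (series u) (series v) _ _ cu' cv').
have tail j N : (j <= N)%N ->
    l1norm (\sum_(l < N) v l - \sum_(l < j) v l) <= 2 * C * 4^-1 ^+ j.
  move=> jN.
  apply: (@le_trans _ _ (2 * C * (4^-1 ^+ j - 4^-1 ^+ N))); last first.
    by rewrite ler_wpM2l ?mulr_ge0// gerBl exprn_ge0//; lra.
  elim: N jN => [|N IH]; first by rewrite leqn0 => /eqP ->; rewrite !subrr l1norm0 mulr0.
  rewrite leq_eqVlt => /predU1P[->|jN]; first by rewrite !subrr l1norm0 mulr0.
  rewrite big_ord_recr/= addrAC (le_trans (l1normD _ _))//.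
  have h1 := IH jN; have h2 := vC N.
  have h3 : 0 <= C * 4^-1 ^+ N by rewrite mulr_ge0// exprn_ge0//; lra.
  apply: (le_trans (lerD h1 h2)).
  have -> : 2 * C * (4^-1 ^+ j - 4^-1 ^+ N.+1) =
    2 * C * (4^-1 ^+ j - 4^-1 ^+ N) + C * 4^-1 ^+ N + 2^-1 * (C * 4^-1 ^+ N).
    by rewrite exprS; field.
  by rewrite lerDl mulr_ge0.
have wb N : l1norm (w N) <= 2 * C ^+ 2 * 2^-1 ^+ N.
  have -> : w N = \sum_(m < N) u m * (\sum_(l < N) v l - \sum_(l < N - m) v l).
    rewrite /w /series/= !big_mkord cauchy_product_partial mulr_suml -sumrB.
    by apply: eq_bigr => m _; rewrite mulrBr.
  apply: (le_trans (l1norm_sum _ _ _)).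
  apply: (@le_trans _ _ (\sum_(m < N) 2 * C ^+ 2 * 4^-1 ^+ N)).
    apply: ler_sum => m _; apply: (le_trans (l1normM _ _)).
    apply: (le_trans (ler_pM (l1norm_ge0 _) (l1norm_ge0 _) (uC m) (tail _ _ (leq_subr m N)))).
    have -> : C * 4^-1 ^+ m * (2 * C * 4^-1 ^+ (N - m)) =
        2 * C ^+ 2 * (4^-1 ^+ m * 4^-1 ^+ (N - m)).
      by ring.
    by rewrite -exprD subnKC// ltnW.
  have c0 : 0 <= 2 * C ^+ 2 by rewrite mulr_ge0// exprn_ge0.
  rewrite sumr_const card_ord; move: (2 * C ^+ 2) c0 => c c0.
  rewrite -[_ *+ N]mulr_natr -mulrA ler_wpM2l//.
  have -> : (4^-1 : R) = 2^-1 * 2^-1 by field.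
  rewrite exprMn -mulrA ler_piMr ?exprn_ge0//.
  rewrite exprVn ler_pdivrMl ?exprn_gt0// mulr1 -natrX ler_nat ltnW// ltn_expl//.
have -> : (0 : R[i]^o) = (0 +i* 0) by [].
apply: cvg_complex.
  by apply: cvg0_geometric_half => N; apply: (le_trans (Re_le_l1norm _)); exact: wb.
by apply: cvg0_geometric_half => N; apply: (le_trans (Im_le_l1norm _)); exact: wb.
Qed.

Lemma cvg_series_l1norm_bounded (v : nat -> R[i]^o) :
  cvgn (series v) -> exists B, forall n, l1norm (v n) <= B.
Proof.
move=> /cvg_series_cvg_0/cvgr0_norm_lt/(_ 1%:C).
rewrite ltcR ltr01 => /(_ isT)[N _ HN].
exists (2 + \sum_(k < N) l1norm (v k)) => n.
have [nN|Nn] := ltnP n N.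
  rewrite (bigD1 (Ordinal nN))//= addrCA lerDl addr_ge0// sumr_ge0// => ? _; exact: l1norm_ge0.
rewrite -[leLHS]addr0 lerD//; last by rewrite sumr_ge0// => ? _; exact: l1norm_ge0.
by rewrite -[leRHS]mulr1 l1norm_le_norm// ltW//; exact: (HN n Nn).
Qed.

End ComplexAbs.

(** * Matrix power series *)

Section MatrixSeries.
Variables (R : realType) (n : nat).
Implicit Types (A B S : nat -> 'M[R[i]]_n) (C K : R).

Definition mx_geom_bounded C K A := forall m i j, l1norm (A m i j) <= C * K ^+ m.

Lemma mx_geom_bounded_term C K A (z : R[i]) m i j : 0 <= K -> mx_geom_bounded C K A ->
  l1norm (z ^+ m * A m i j) <= C * (l1norm z * K) ^+ m.
Proof.
move=> K0 gA; rewrite (le_trans (l1normM _ _))//.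
rewrite exprMn mulrCA ler_pM ?l1norm_ge0//; exact: l1normX.
Qed.

Lemma mx_geom_bounded_positive_radius C K A : 0 < K -> mx_geom_bounded C K A -> positive_radius A.
Proof.
move=> K0 gA; exists (4 * K)^-1; first by rewrite invr_gt0 mulr_gt0.
move=> z zK i j.
have hz : 2 * (4 * K)^-1 * K = 2^-1 :> R by field; rewrite gt_eqF.
have q1 : 0 <= l1norm z * K < 1.
  rewrite mulr_ge0 ?l1norm_ge0 ?ltW//=.
  apply: (@le_lt_trans _ _ (2 * (4 * K)^-1 * K)); last by rewrite hz invf_lt1// ltr1n.
  by rewrite ler_pM2r// l1norm_le_norm// ltW.
exact: cvgP (cvg_series_complex q1 (fun m => mx_geom_bounded_term z m i j (ltW K0) gA)).
Qed.

(** At z = r / 2 the terms of each entry are bounded, since the series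
    converges. *)
Lemma positive_radius_mx_geom_bounded A : positive_radius A ->
  exists C K, [/\ 0 <= C, 0 < K & mx_geom_bounded C K A].
Proof.
move=> [r r0 rA].
have r2 : 0 < r / 2 by rewrite divr_gt0.
have zr : `|(r / 2)%:C| < r%:C.
  rewrite normc_def/= expr0n/= addr0 sqrtr_sqr ltcR gtr0_norm//.
  by rewrite ltr_pdivrMr// ltr_pMr// ltr1n.
have bnd i j : exists B : R, forall m, l1norm ((r / 2)%:C ^+ m * A m i j) <= B.
  exact: (cvg_series_l1norm_bounded (rA _ zr i j)).
have [B hB] := choice (fun ij => bnd ij.1 ij.2).
have B0 ij : 0 <= B ij by apply: le_trans (hB ij 0%N); exact: l1norm_ge0.
exists (\sum_ij B ij), (r / 2)^-1; split; [by rewrite sumr_ge0|by rewrite invr_gt0|].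
move=> m i j; have := hB (i, j) m; rewrite /= -rmorphXn l1normM_real.
rewrite ger0_norm ?exprn_ge0 ?(ltW r2)// => h.
rewrite exprVn ler_pdivlMr ?exprn_gt0// mulrC (le_trans h)//.
exact: (ler_term_sum (i, j)).
Qed.

Lemma mx_geom_bounded_conj C K A (P Q : 'M[R[i]]_n) :
  0 <= C -> 0 <= K -> mx_geom_bounded C K A ->
  exists2 C', 0 <= C' & mx_geom_bounded C' K (fun m => P *m A m *m Q).
Proof.
move=> C0 K0 gA.
pose S := \sum_i \sum_j \sum_k \sum_l l1norm (P i l) * l1norm (Q k j).
have S0 i j : 0 <= \sum_k \sum_l l1norm (P i l) * l1norm (Q k j).
  by rewrite sumr_ge0// => k _; rewrite sumr_ge0// => l _; rewrite mulr_ge0 ?l1norm_ge0.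
exists (S * C).
  by rewrite mulr_ge0// sumr_ge0// => i _; rewrite sumr_ge0.
move=> m i j; rewrite mxE (le_trans (l1norm_sum _ _ _))//.
apply: (@le_trans _ _ ((\sum_k \sum_l l1norm (P i l) * l1norm (Q k j)) * (C * K ^+ m))).
  rewrite mulr_suml; apply: ler_sum => k _; rewrite (le_trans (l1normM _ _))//.
  rewrite mxE; apply: (le_trans (ler_wpM2r (l1norm_ge0 _) (l1norm_sum _ _ _))).
  rewrite !mulr_suml; apply: ler_sum => l _.
  rewrite mulrAC ler_wpM2r ?l1norm_ge0//.
  by rewrite (le_trans (l1normM _ _))// ler_wpM2l ?l1norm_ge0.
rewrite mulrA ler_wpM2r ?exprn_ge0// ler_wpM2r// /S.
rewrite (le_trans (ler_term_sum j (S0 i)))//.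
apply: (ler_term_sum (F := fun i => \sum_j \sum_k \sum_l l1norm (P i l) * l1norm (Q k j))).
by move=> i'; rewrite sumr_ge0.
Qed.

Lemma mxps_sum_real C K A (x : R) i j : 0 <= K -> mx_geom_bounded C K A -> 0 <= x ->
  x * K < 1 ->
  mxps_sum A x%:C i j = limn (pseries (fun m => complex.Re (A m i j)) x) +i*
                        limn (pseries (fun m => complex.Im (A m i j)) x).
Proof.
move=> K0 gA x0 xK.
have q1 : 0 <= l1norm x%:C * K < 1.
  by rewrite l1norm_real ger0_norm// mulr_ge0.
have := cvg_series_complex q1 (fun m => mx_geom_bounded_term x%:C m i j K0 gA).
rewrite mxE => /cvg_lim ->; last exact: norm_hausdorff.
rewrite /pseries; congr (limn (series _) +i* limn (series _)); apply/funext => m.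
  by rewrite -rmorphXn ReM_real mulrC.
by rewrite -rmorphXn ImM_real mulrC.
Qed.

(** Entrywise, this is a finite sum of Cauchy products. *)
Lemma mxps_mul C K A S (x : R) i j :
  0 <= K -> mx_geom_bounded C K A -> mx_geom_bounded C K S ->
  0 <= x -> x * K <= 4^-1 ->
  series (fun k => x%:C ^+ k * \sum_(m < k.+1) (A m *m S (k - m)%N) i j : R[i]^o)
    @ \oo --> ((mxps_sum A x%:C *m mxps_sum S x%:C) i j : R[i]^o).
Proof.
move=> K0 gA gS x0 xK.
have C0 : 0 <= C.
  by have := gA 0%N i j; rewrite expr0 mulr1; apply: le_trans; exact: l1norm_ge0.
have bnd B m p q : mx_geom_bounded C K B -> l1norm (x%:C ^+ m * B m p q) <= C * 4^-1 ^+ m.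
  move=> gB; rewrite (le_trans (mx_geom_bounded_term _ _ _ _ K0 gB))// ler_wpM2l//.
  by rewrite lerXn2r// ?nnegrE ?l1norm_real ?ger0_norm// ?mulr_ge0// invr_ge0.
have cau l := @cauchy_product R _ _ C (fun m => bnd A m i l gA) (fun m => bnd S m l j gS).
have -> : (mxps_sum A x%:C *m mxps_sum S x%:C) i j =
   \sum_l limn (series (fun m => x%:C ^+ m * A m i l : R[i]^o)) *
          limn (series (fun m => x%:C ^+ m * S m l j : R[i]^o)).
  by rewrite mxE; apply: eq_bigr => l _; rewrite !mxE.
have -> : series (fun k => x%:C ^+ k * \sum_(m < k.+1) (A m *m S (k - m)%N) i j) =
  (fun N => \sum_l series (fun k => \sum_(m < k.+1) (x%:C ^+ m * A m i l) *
     (x%:C ^+ (k - m) * S (k - m)%N l j)) N) :> (nat -> R[i]^o).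
  apply/funext => N; rewrite /series/= exchange_big/=; apply: eq_bigr => k _.
  rewrite exchange_big/= mulr_sumr; apply: eq_bigr => m _.
  rewrite mxE mulr_sumr; apply: eq_bigr => l _.
  rewrite mulrACA -exprD subnKC//; by rewrite -ltnS.
apply: cvg_big => [|l _]; [move=> p|exact: cau].
by apply: (@cvgD R[i] R[i]^o _ _ _ fst snd); [exact: cvg_fst|exact: cvg_snd].
Qed.

End MatrixSeries.

(** * The recursion for the coefficients *)

(** The n-th stage stores the values below n; defaults are never read. *)
Lemma strong_rec (T : Type) (F : nat -> (nat -> T) -> T) :
  inhabited T ->
  (forall n f g, (forall k, (k < n)%N -> f k = g k) -> F n f = F n g) ->
  exists u : nat -> T, forall n, u n = F n u.
Proof.
move=> [t0] FE.
pose S := fix S n : nat -> T :=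
  if n is n'.+1 then fun k => if k == n' then F n' (S n') else S n' k else fun=> t0.
have SE n k : (k < n)%N -> S n k = S k.+1 k.
  elim: n => // n IH; rewrite ltnS leq_eqVlt => /predU1P[->//|kn].
  by rewrite [LHS]/= (ltn_eqF kn) IH.
exists (fun n => S n.+1 n) => n; rewrite [LHS]/= eqxx.
by apply: FE => k kn; exact: SE.
Qed.

Section Recursion.
Variables (R : realType) (n : nat) (a : R).
Variables (A : nat -> 'M[R[i]]_n) (lambda : 'I_n -> R).
Hypothesis a01 : 0 < a < 1.
Hypothesis A0 : A 0%N = diag_mx (\row_i (lambda i)%:C).
Hypothesis good : good_spectrum a lambda.

Let g j := rho_inv a (lambda j).
Let g1 j : -1 < g j. Proof. by have [] := rho_invP a01 (lambda j). Qed.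
Let rhog j : rho a (g j) = lambda j. Proof. by have [] := rho_invP a01 (lambda j). Qed.

Let den k i j : R := rho a (a * k%:R + g j) - lambda i.

(** With lambda_i = rho(g_i) and rho injective, equality would force
    g_i - g_j = a k, which a good spectrum excludes. *)
Lemma nonresonant k i j : (0 < k)%N -> rho a (a * k%:R + g j) != lambda i.
Proof.
move=> k0; apply/eqP; rewrite -rhog => /rho_inj e.
have /andP[a0 _] := a01; have := g1 i; have := g1 j; have := mulr_ge0 (ltW a0) (ler0n R k).
move=> h1 h2 h3; have {}e : a * k%:R + g j = g i by apply: e => //; lra.
apply: (good (i := j) (j := i) k0); rewrite -/(g i) -/(g j) -e; ring.
Qed.

Lemma den_bounded : exists2 D, 0 <= D &
  forall k i j, (0 < k)%N -> `|den k i j|^-1 <= D.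
Proof.
have H ij : exists D, 0 <= D /\ forall k, (0 < k)%N -> `|den k ij.1 ij.2|^-1 <= D.
  have [D D0 hD] := rho_sub_inv_bounded a01 (g1 ij.2) (fun k => @nonresonant k ij.1 ij.2).
  by exists D.
have [D hD] := choice H.
have D0 ij : 0 <= D ij by have [] := hD ij.
exists (\sum_ij D ij); first by rewrite sumr_ge0.
move=> k i j k0; have [_ /(_ k k0)/= h] := hD (i, j).
by rewrite (le_trans h)// (ler_term_sum (i, j)).
Qed.

Lemma frobenius_coefs_exist : exists S : nat -> 'M[R[i]]_n,
  S 0%N = 1%:M /\ forall k i j, S k.+1 i j =
    ((den k.+1 i j)^-1)%:C * \sum_(m < k.+1) (A m.+1 *m S (k - m)%N) i j.
Proof.
pose F k (f : nat -> 'M[R[i]]_n) : 'M[R[i]]_n := if k is k'.+1 then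
  \matrix_(i, j) (((den k i j)^-1)%:C * \sum_(m < k) (A m.+1 *m f (k' - m)%N) i j)
  else 1%:M.
have [|S hS] := @strong_rec _ F (inhabits 0).
  move=> [//|k] f h fh; apply/matrixP => i j; rewrite !mxE; congr (_ * _).
  by apply: eq_bigr => m _; rewrite fh// ltnS leq_subr.
exists S; split; first by rewrite hS.
by move=> k i j; rewrite hS mxE.
Qed.

Section Coefficients.
Variable S : nat -> 'M[R[i]]_n.
Hypothesis S0 : S 0%N = 1%:M.
Hypothesis SS : forall k i j, S k.+1 i j =
    ((den k.+1 i j)^-1)%:C * \sum_(m < k.+1) (A m.+1 *m S (k - m)%N) i j.

(** In degree k the product A S contains the term lambda_i S_k(i, j) with m = 0;
    moving it to the left-hand side leaves the divisor of the recursion. *)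
Lemma frobenius_coefs_eq k i j : (rho a (a * k%:R + g j))%:C * S k i j =
  \sum_(m < k.+1) (A m *m S (k - m)%N) i j.
Proof.
rewrite big_ord_recl/= subn0 A0 mul_diag_mx mxE mxE.
case: k => [|k].
  rewrite big_ord0 addr0 mulr0 add0r rhog S0 mxE.
  by case: eqVneq => [->//|_]; rewrite !mulr0.
have -> : \sum_(i0 < k.+1) (A (bump 0 i0) *m S (k.+1 - bump 0 i0)%N) i j =
  (den k.+1 i j)%:C * S k.+1 i j.
  rewrite SS mulrA -rmorphM divff; last by rewrite subr_eq0 nonresonant.
  by rewrite mul1r; apply: eq_bigr => m _; rewrite /bump/= add1n subSS.
by rewrite -mulrDl -rmorphD /den addrCA subrr addr0.
Qed.

(** By induction |S_k| <= K'^k: with q = D n C the recursion bounds |S_k| by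
    q times the sum over m < k of K^(m+1) K'^(k-1-m), and the choice
    K' = K (1 + q), that is K' - K = q K, makes this equal to K'^k - K^k. *)
Lemma frobenius_coefs_geom C K : 0 <= C -> 0 < K -> mx_geom_bounded C K A ->
  exists2 K', K <= K' & mx_geom_bounded 1 K' S.
Proof.
move=> C0 K0 gA; have [D D0 hD] := den_bounded.
pose q := D * n%:R * C.
have q0 : 0 <= q by rewrite !mulr_ge0.
pose K' := K * (1 + q).
have KK' : K <= K' by rewrite ler_peMr ?(ltW K0)// lerDl.
have K'0 : 0 <= K' by rewrite (le_trans _ KK')// ltW.
exists K' => // k; elim/ltn_ind: k => -[|k] IH i j.
  rewrite S0 mxE mul1r expr0; case: (i == j).
    by rewrite -[1%:R]/(1%:C) l1norm_real normr1.
  by rewrite l1norm0.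
rewrite SS l1normM_real normfV mul1r.
apply: (@le_trans _ _ (D * \sum_(m < k.+1) (n%:R * C * K ^+ m.+1 * K' ^+ (k - m)))).
  apply: ler_pM; rewrite ?invr_ge0 ?l1norm_ge0//; first exact: hD.
  apply: (le_trans (l1norm_sum _ _ _)); apply: ler_sum => m _.
  rewrite mxE (le_trans (l1norm_sum _ _ _))//.
  have -> : n%:R * C * K ^+ m.+1 * K' ^+ (k - m) =
      \sum_(l < n) (C * K ^+ m.+1 * K' ^+ (k - m)).
    by rewrite sumr_const card_ord -[RHS]mulr_natl !mulrA.
  apply: ler_sum => l _; rewrite (le_trans (l1normM _ _))// ler_pM ?l1norm_ge0//.
  by have := IH (k - m)%N; rewrite mul1r; apply; rewrite ltnS leq_subr.
have -> : D * \sum_(m < k.+1) (n%:R * C * K ^+ m.+1 * K' ^+ (k - m)) = K' ^+ k.+1 - K ^+ k.+1.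
  rewrite subrXX !mulr_sumr; apply: eq_bigr => m _.
  by rewrite /K' /q exprS/=; ring.
by rewrite gerBl exprn_ge0// ltW.
Qed.

End Coefficients.
End Recursion.

(** * The fundamental solution *)

Section Solution.
Variables (R : realType) (n : nat) (a : R).
Variables (A S : nat -> 'M[R[i]]_n) (lambda : 'I_n -> R).
Hypothesis a01 : 0 < a < 1.
Variables (C K : R).
Hypothesis K0 : 0 < K.
Hypothesis gA : mx_geom_bounded C K A.
Hypothesis gS : mx_geom_bounded C K S.
Let g j := rho_inv a (lambda j).
Hypothesis SE : forall k i j, (rho a (a * k%:R + g j))%:C * S k i j =
  \sum_(m < k.+1) (A m *m S (k - m)%N) i j.

Let u s := mxps_sum S (s `^ a)%:C *m psi a lambda s.

Lemma solutionE s i j : s `^ a * K < 1 ->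
  u s i j = (limn (pseries (fun m => complex.Re (S m i j)) (s `^ a)) * s `^ g j) +i*
            (limn (pseries (fun m => complex.Im (S m i j)) (s `^ a)) * s `^ g j).
Proof.
move=> sK; rewrite /u mul_mx_diag mxE [X in _ * X]mxE.
rewrite (mxps_sum_real _ _ (ltW K0) gS (powR_ge0 _ _) sK).
by rewrite mulrC; apply/eqP; rewrite eq_complex ReM_real ImM_real/= !(mulrC (s `^ _)) !eqxx.
Qed.

(** By [RL_derive_series] the left-hand side of the system has the coefficients
    rho(a k + g_j) S_k(i, j), by [mxps_mul] the right-hand side has those of the
    product series, and [SE] says that they agree. *)
Lemma solves_near0 : \forall t \near 0^'+, solves_system_at a A u t.
Proof.
have /andP[a0 a1] := a01.
(* s1^a = 1 / (16 K) leaves room for the bounds s^a * (8 * K) < 1 and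
   s^a * K <= 1/4 of the two lemmas. *)
pose s1 := (16 * K)^-1 `^ a^-1.
have K16 : 0 < (16 * K)^-1 by rewrite invr_gt0 mulr_gt0.
have s10 : 0 < s1 by rewrite powR_gt0.
have s1a : s1 `^ a = (16 * K)^-1.
  by rewrite /s1 -powRrM mulVf ?gt_eqF// powRr1// ltW.
have s1K : s1 `^ a * (8 * K) < 1.
  by rewrite s1a mulrC ltr_pdivrMr ?mulr_gt0// mul1r ltr_pM2r// ltr_nat.
near=> t.
have t0 : 0 < t by near: t; exact: nbhs_right_gt.
have ts1 : t < s1 by near: t; exact: nbhs_right_lt.
have sK s : 0 < s -> s < s1 -> s `^ a * K <= 16^-1.
  move=> s0 ss1; have -> : 16^-1 = s1 `^ a * K.
    by rewrite s1a; field; rewrite gt_eqF.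
  by rewrite ler_pM2r// ler_powRl// ltW.
have sK1 s : 0 < s -> s < s1 -> s `^ a * K < 1.
  move=> s0 ss1; apply: le_lt_trans (sK s s0 ss1) _; lra.
have tK : t `^ a * K <= 4^-1 by apply: le_trans (sK t t0 ts1) _; lra.
have gcRe i j : geom_bounded C K (fun m => complex.Re (S m i j)).
  by move=> m; apply: le_trans (gS m i j); exact: Re_le_l1norm.
have gcIm i j : geom_bounded C K (fun m => complex.Im (S m i j)).
  by move=> m; apply: le_trans (gS m i j); exact: Im_le_l1norm.
have g1 j : -1 < g j by have [] := rho_invP a01 (lambda j).
have t01 : 0 < t < s1 by rewrite t0.
have uE s i j : 0 < s < s1 -> u s i j =
    (limn (pseries (fun m => complex.Re (S m i j)) (s `^ a)) * s `^ g j) +i*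
    (limn (pseries (fun m => complex.Im (S m i j)) (s `^ a)) * s `^ g j).
  by move=> /andP[s0 ss1]; apply: solutionE; exact: sK1.
have HRe i j := RL_derive_series a01 (g1 j) K0 (gcRe i j)
  (f := fun s => complex.Re (u s i j)) t01 s1K
  (fun s hs => congr1 (@complex.Re R) (uE s i j hs)).
have HIm i j := RL_derive_series a01 (g1 j) K0 (gcIm i j)
  (f := fun s => complex.Im (u s i j)) t01 s1K
  (fun s hs => congr1 (@complex.Im R) (uE s i j hs)).
split; first by move=> i j; split; [have [] := HRe i j|have [] := HIm i j].
apply/matrixP => i j.
have [_ dRe] := HRe i j; have [_ dIm] := HIm i j.
pose w k : R[i]^o := (t `^ a)%:C ^+ k * \sum_(m < k.+1) (A m *m S (k - m)%N) i j.
have cau : series w @ \oo -->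
    ((mxps_sum A (t `^ a)%:C *m mxps_sum S (t `^ a)%:C) i j : R[i]^o).
  exact: (mxps_mul (i := i) (j := j) (ltW K0) gA gS (powR_ge0 t a) tK).
have -> : (mxps_sum A (t `^ a)%:C *m u t) i j =
    (mxps_sum A (t `^ a)%:C *m mxps_sum S (t `^ a)%:C) i j * (t `^ g j)%:C.
  by rewrite /u mulmxA mul_mx_diag mxE; congr (_ * _); rewrite mxE.
have -> : ((t `^ a)%:C *: mxRL_derive a u t) i j = (t `^ a)%:C *
    (RL_derive a (fun s => complex.Re (u s i j)) t +i*
     RL_derive a (fun s => complex.Im (u s i j)) t).
  by rewrite mxE; congr (_ * _); rewrite mxE.
move: ((mxps_sum A _ *m mxps_sum S _) i j) cau => M cau.
have LRe : limn (pseries (fun k =>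
    rho a (a * k%:R + g j) * complex.Re (S k i j)) (t `^ a)) = complex.Re M.
  apply/cvg_lim => //; rewrite (_ : pseries _ _ = fun N => complex.Re (series w N)).
    exact: cvg_Re cau.
  apply/funext => N; rewrite /pseries /series/= raddf_sum; apply: eq_bigr => k _.
  by rewrite /w -SE -rmorphXn/= !ReM_real mulrC.
have LIm : limn (pseries (fun k =>
    rho a (a * k%:R + g j) * complex.Im (S k i j)) (t `^ a)) = complex.Im M.
  apply/cvg_lim => //; rewrite (_ : pseries _ _ = fun N => complex.Im (series w N)).
    exact: cvg_Im cau.
  apply/funext => N; rewrite /pseries /series/= raddf_sum; apply: eq_bigr => k _.
  by rewrite /w -SE -rmorphXn/= !ImM_real mulrC.
apply/eqP; rewrite eq_complex ReM_real ImM_real [M * _]mulrC ReM_real ImM_real/=.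
by rewrite dRe dIm LRe LIm ![_ * (t `^ _)]mulrC !eqxx.
Unshelve. all: by end_near. Qed.

End Solution.

Theorem theorem2 (R : realType) (n : nat) (alpha : R)
  (A : nat -> 'M[R[i]]_n) (lambda : 'I_n -> R) (U : 'M[R[i]]_n)
  (halpha : 0 < alpha < 1)
  (hA : positive_radius A)
  (hA0 : A 0%N \is hermsymmx)
  (hlambda : char_poly (A 0%N) = \prod_(i < n) ('X - ((lambda i)%:C)%:P))
  (hU : U \is unitarymx)
  (hUA0 : U ^t* *m A 0%N *m U = diag_mx (\row_i (lambda i)%:C))
  (hgood : good_spectrum alpha lambda) :
  exists sigma : nat -> 'M[R[i]]_n,
    [/\ sigma 0%N = 1%:M,
        positive_radius sigma
      & \forall t \near 0^'+,
          solves_system_at alpha (fun m => U ^t* *m A m *m U)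
            (fun s => mxps_sum sigma (s `^ alpha)%:C *m psi alpha lambda s) t].
Proof.
have [C0 [K0 [C00 K00 gA0]]] := positive_radius_mx_geom_bounded hA.
have [C C0' gA] := mx_geom_bounded_conj (U ^t*) U C00 (ltW K00) gA0.
have [S [S0 SS]] := frobenius_coefs_exist alpha (fun m => U ^t* *m A m *m U) lambda.
have [K' KK' gS] := frobenius_coefs_geom halpha hgood S0 SS C0' K00 gA.
have K'0 : 0 < K' by exact: lt_le_trans KK'.
have gS' : mx_geom_bounded (C + 1) K' S.
  by move=> m i j; rewrite (le_trans (gS m i j))// ler_wpM2r ?lerDr// exprn_ge0// ltW.
have gA' : mx_geom_bounded (C + 1) K' (fun m => U ^t* *m A m *m U).
  move=> m i j; rewrite (le_trans (gA m i j))// ler_pM ?exprn_ge0 ?(ltW K00) ?lerDl//.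
  by rewrite lerXn2r// nnegrE ltW.
exists S; split; [exact: S0|exact: mx_geom_bounded_positive_radius gS|].
apply: (solves_near0 halpha K'0 gA' gS') => k i j.
exact: (frobenius_coefs_eq (A := fun m => U ^t* *m A m *m U) halpha hUA0 hgood S0 SS).
Qed.
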